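(* Consider a many-body quantum system on a finite set of sites (finite-dimensional Hilbert space), and let $E$ be a finite collection of local supports (sets of sites). Let $H_{\mathrm{Re}}$ be Hermitian and, for each $\ell\in E$, let $H_{\mathrm{I},\ell}$ be a Hermitian operator acting nontrivially only on the sites in $\ell$ and let $\gamma_\ell>0$. Let $\mathcal L,\mathcal L_{\mathrm{NH}},\mathcal L_{\mathrm J}$ be the superoperators defined in the context. For each $\ell\in E$ let $\{\mathcal B_{\ell j}\}_{j\ge1}$ be a finite list of local basis operation channels on $\ell$ (possibly trace-decreasing), assumed to span the local superoperator space on that support. Expand $$-\mathcal L_{\mathrm J}=q_0\,\mathcal I+\sum_{\ell\in E}\sum_{j\ge1}q_{\ell j}\,\mathcal B_{\ell j}$$ with real coefficients $q_0,q_{\ell j}$. For small $\delta t>0$ put $$c(\delta t)=1+\delta t\Bigl(q_0+\sum_{\ell\in E}\sum_{j\ge1}|q_{\ell j}|\Bigr),\quad p_0=\frac{1+q_0\delta t}{c(\delta t)},\quad p_{(\ell,j)}=\frac{|q_{\ell j}|\,\delta t}{c(\delta t)},\quad \alpha_0=1,\quad \alpha_{(\ell,j)}=\operatorname{sgn}(q_{\ell j}).$$ Let $\rho(0)$ be the initial density operator, $O$ an observable, and $T=n\,\delta t$ with $n\in\mathbb N$. For a sequence $\vec j=(j_0,\dots,j_{n-1})$, each $j_k$ being either $0$ (with $\mathcal B_0=\mathcal I$) or a pair $(\ell,j)$ (with $\mathcal B_{(\ell,j)}=\mathcal B_{\ell j}$), put $p_{\vec j}=\prod_{k=0}^{n-1}p_{j_k}$,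 $\alpha_{\vec j}=\prod_{k=0}^{n-1}\alpha_{j_k}$ and $$\rho_{\vec j}(T)=\bigl(\mathcal B_{j_{n-1}}\circ e^{\delta t\mathcal L}\circ\cdots\circ\mathcal B_{j_0}\circ e^{\delta t\mathcal L}\bigr)[\rho(0)].$$ Let $\rho_{\mathrm{NH}}(T)=\bigl(e^{\delta t\mathcal L_{\mathrm{NH}}}\bigr)^n[\rho(0)]$. Then $$\operatorname{Tr}[O\rho_{\mathrm{NH}}(T)]=c(\delta t)^n\sum_{\vec j}\alpha_{\vec j}\,p_{\vec j}\,\operatorname{Tr}[O\rho_{\vec j}(T)]+\mathcal O(T\delta t),$$ and the normalized expectation value is, in the limit $\delta t\to0^+$, $$\frac{\operatorname{Tr}[O\rho_{\mathrm{NH}}(T)]}{\operatorname{Tr}[\rho_{\mathrm{NH}}(T)]}=\frac{\sum_{\vec j}\alpha_{\vec j}\,p_{\vec j}\operatorname{Tr}[O\rho_{\vec j}(T)]}{\sum_{\vec j}\alpha_{\vec j}\,p_{\vec j}\operatorname{Tr}[\rho_{\vec j}(T)]}.$$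
   Context: $\mathcal I$ is the identity superoperator, $[\cdot,\cdot]$ the commutator and $\{\cdot,\cdot\}$ the anticommutator. The GKSL generator is $\mathcal L=\mathcal L_{\mathrm{NH}}+\mathcal L_{\mathrm J}$ with $$\mathcal L_{\mathrm{NH}}[\rho]=-i[H_{\mathrm{Re}},\rho]-\sum_{\ell\in E}\gamma_\ell\{H_{\mathrm{I},\ell}^2,\rho\},\qquad \mathcal L_{\mathrm J}[\rho]=\sum_{\ell\in E}2\gamma_\ell H_{\mathrm{I},\ell}\,\rho\, H_{\mathrm{I},\ell}.$$ A basis operation channel is a map of the form $\rho\mapsto A\rho A^\dagger$ with $A^\dagger A\le I$ (for instance a unitary operation or a projective-measurement outcome), where $A$ acts on the sites of $\ell$. The remainder $\mathcal O(T\delta t)$ comes from the first-order discretization in $\delta t$ over the $n=T/\delta t$ steps. *)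

(* Defs.v *)
From HB Require Import structures.
From mathcomp Require Import all_boot all_order all_algebra.
From mathcomp Require Import complex.
From mathcomp Require Import reals topology normedtype sequences.

Set Implicit Arguments.
Unset Strict Implicit.
Unset Printing Implicit Defensive.

Import Order.TTheory GRing.Theory Num.Theory.
Import numFieldNormedType.Exports.

Local Open Scope ring_scope.
Local Open Scope sesquilinear_scope.
Local Open Scope complex_scope.

(* The orthonormal product basis of the system is indexed by configurations:
   site s has local dimension d s.  The sites of a support X have their own
   configurations, which index the basis of the Hilbert space on X. *)
Definition config (S : finType) (d : S -> nat) : finType :=
  {dffun forall s : S, 'I_(d s)}.

Definition lconfig (S : finType) (d : S -> nat) (X : {set S}) : finType :=
  {dffun forall s : {s : S | s \in X}, 'I_(d (val s))}.

Definition restr (S : finType) (d : S -> nat) (X : {set S})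
    (x : {dffun forall s : S, 'I_(d s)}) : lconfig d X :=
  finfun (fun s : {s : S | s \in X} => x (val s)).

Definition op (R : realType) (S : finType) (d : S -> nat) : Type :=
  'M[R[i]]_#|config d|.

Definition lop (R : realType) (S : finType) (d : S -> nat) (X : {set S}) : Type :=
  'M[R[i]]_#|lconfig d X|.

(* The operator a (x) 1, with a on the sites of X and 1 on the other sites. *)
Definition embed (R : realType) (S : finType) (d : S -> nat) (X : {set S})
    (a : lop R d X) : op R d :=
  \matrix_(i, j)
    let x : {dffun forall s : S, 'I_(d s)} := enum_val i in
    let y : {dffun forall s : S, 'I_(d s)} := enum_val j in
    if [forall s : S, (s \notin X) ==> (x s == y s)]
    then a (enum_rank (restr X x)) (enum_rank (restr X y)) else 0.

Definition acts_on (R : realType) (S : finType) (d : S -> nat) (X : {set S})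
    (A : op R d) : Prop :=
  exists a : lop R d X, A = embed a.

(* In R[i], 0 <= z means that z is real and nonnegative. *)
Definition psd (R : realType) (N : nat) (A : 'M[R[i]]_N) : Prop :=
  forall v : 'cV[R[i]]_N, 0 <= (v ^t* *m A *m v) 0 0.

Definition density (R : realType) (N : nat) (rho : 'M[R[i]]_N) : Prop :=
  psd rho /\ \tr rho = 1.

Definition comm (R : realType) (N : nat) (A B : 'M[R[i]]_N) : 'M[R[i]]_N :=
  A *m B - B *m A.

Definition acomm (R : realType) (N : nat) (A B : 'M[R[i]]_N) : 'M[R[i]]_N :=
  A *m B + B *m A.

Definition LNH (R : realType) (N : nat) (E : finType) (HRe : 'M[R[i]]_N)
    (HI : E -> 'M[R[i]]_N) (gamma : E -> R) (rho : 'M[R[i]]_N) : 'M[R[i]]_N :=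
  - ('i *: comm HRe rho)
  - \sum_(l : E) (gamma l)%:C *: acomm (HI l *m HI l) rho.

Definition LJ (R : realType) (N : nat) (E : finType)
    (HI : E -> 'M[R[i]]_N) (gamma : E -> R) (rho : 'M[R[i]]_N) : 'M[R[i]]_N :=
  \sum_(l : E) (2 * gamma l)%:C *: (HI l *m rho *m HI l).

Definition gksl (R : realType) (N : nat) (E : finType) (HRe : 'M[R[i]]_N)
    (HI : E -> 'M[R[i]]_N) (gamma : E -> R) (rho : 'M[R[i]]_N) : 'M[R[i]]_N :=
  LNH HRe HI gamma rho + LJ HI gamma rho.

(* R[i] carries no canonical topology for a realType R, so limits are taken on
   real and imaginary parts, and entrywise for matrices in expS. *)
Definition climn (R : realType) (u : nat -> R[i]) : R[i] :=
  limn (fun k => complex.Re (u k)) +i* limn (fun k => complex.Im (u k)).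

Definition expS (R : realType) (N : nat)
    (F : 'M[R[i]]_N -> 'M[R[i]]_N) (rho : 'M[R[i]]_N) : 'M[R[i]]_N :=
  \matrix_(i, j)
    climn (fun n => (\sum_(k < n) (k`!%:R)^-1 *: iter k F rho) i j).

Definition evol (R : realType) (N : nat)
    (L : 'M[R[i]]_N -> 'M[R[i]]_N) (t : R) : 'M[R[i]]_N -> 'M[R[i]]_N :=
  expS (fun rho => t%:C *: L rho).

Definition chan (R : realType) (N : nat) (A rho : 'M[R[i]]_N) : 'M[R[i]]_N :=
  A *m rho *m A ^t*.

Definition contractive (R : realType) (N : nat) (A : 'M[R[i]]_N) : Prop :=
  psd (1%:M - A ^t* *m A).

(* Superoperators are complex-linear maps, hence complex coefficients. *)
Definition chan_span (R : realType) (N m : nat) (A : 'I_m -> 'M[R[i]]_N) : Prop :=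
  forall Phi : {linear 'M[R[i]]_N -> 'M[R[i]]_N},
  exists c : 'I_m -> R[i],
  forall rho, Phi rho = \sum_(j < m) c j *: chan (A j) rho.

(* One step of a trajectory: None is the index 0, Some (l, j) a pair. *)
Definition step (E : finType) (m : E -> nat) : finType :=
  option {l : E & 'I_(m l)}.

Definition stepchan (R : realType) (S : finType) (d : S -> nat) (E : finType)
    (supp : E -> {set S}) (m : E -> nat)
    (A : forall l : E, 'I_(m l) -> lop R d (supp l))
    (s : step m) (rho : op R d) : op R d :=
  if s is Some lj then chan (embed (A (tag lj) (tagged lj))) rho else rho.

Definition expansion (R : realType) (S : finType) (d : S -> nat) (E : finType)
    (supp : E -> {set S}) (m : E -> nat)
    (A : forall l : E, 'I_(m l) -> lop R d (supp l))
    (HI : E -> op R d) (gamma : E -> R)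
    (q0 : R) (q : forall l : E, 'I_(m l) -> R) : Prop :=
  forall rho : op R d,
    - LJ HI gamma rho
    = q0%:C *: rho
      + \sum_(l : E) \sum_(j < m l) (q l j)%:C *: chan (embed (A l j)) rho.

Definition cfac (R : realType) (E : finType) (m : E -> nat)
    (q0 : R) (q : forall l : E, 'I_(m l) -> R) (dt : R) : R :=
  1 + dt * (q0 + \sum_(l : E) \sum_(j < m l) `|q l j|).

Definition prob (R : realType) (E : finType) (m : E -> nat)
    (q0 : R) (q : forall l : E, 'I_(m l) -> R) (dt : R) (s : step m) : R :=
  if s is Some lj then `|q (tag lj) (tagged lj)| * dt / cfac q0 q dt
  else (1 + q0 * dt) / cfac q0 q dt.

Definition sign (R : realType) (E : finType) (m : E -> nat)
    (q : forall l : E, 'I_(m l) -> R) (s : step m) : R :=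
  if s is Some lj then Num.sg (q (tag lj) (tagged lj)) else 1.

(* rho_j(T): in each step first the evolution exp(dt L), then the channel. *)
Definition traj (R : realType) (S : finType) (d : S -> nat) (E : finType)
    (supp : E -> {set S}) (m : E -> nat)
    (A : forall l : E, 'I_(m l) -> lop R d (supp l))
    (L : op R d -> op R d) (dt : R) (n : nat) (js : n.-tuple (step m))
    (rho0 : op R d) : op R d :=
  foldl (fun rho s => stepchan A s (evol L dt rho)) rho0 js.

Definition signed_avg (R : realType) (S : finType) (d : S -> nat) (E : finType)
    (supp : E -> {set S}) (m : E -> nat)
    (A : forall l : E, 'I_(m l) -> lop R d (supp l))
    (L : op R d -> op R d) (q0 : R) (q : forall l : E, 'I_(m l) -> R)
    (dt : R) (n : nat) (rho0 Obs : op R d) : R[i] :=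
  \sum_(js : n.-tuple (step m))
    (\prod_(k < n) sign q (tnth js k))%:C
    * (\prod_(k < n) prob q0 q dt (tnth js k))%:C
    * \tr (Obs *m traj A L dt js rho0).

Definition rhoNH (R : realType) (N : nat) (E : finType) (HRe : 'M[R[i]]_N)
    (HI : E -> 'M[R[i]]_N) (gamma : E -> R) (dt : R) (n : nat)
    (rho0 : 'M[R[i]]_N) : 'M[R[i]]_N :=
  iter n (evol (LNH HRe HI gamma) dt) rho0.

(* Main.v *)
Require Import Defs.
From HB Require Import structures.
From mathcomp Require Import all_boot all_order all_algebra.
From mathcomp Require Import complex.
From mathcomp Require Import boolp reals topology normedtype sequences exp.
From mathcomp Require Import ring lra.

Set Implicit Arguments.
Unset Strict Implicit.
Unset Printing Implicit Defensive.

Import Order.TTheory GRing.Theory Num.Theory.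
Import numFieldNormedType.Exports.
Import ComplexField.Normc.
Local Open Scope ring_scope.
Local Open Scope sesquilinear_scope.
Local Open Scope complex_scope.

(* Write [L_NH X = G X + X G^*] with [G = - i H_Re - \sum_l gamma_l H_l^2], and compare both evolutions with the
   Euler map [P X = (1 + t G) X (1 + t G)^*].  One step of either the exact non-Hermitian evolution or the signed
   average, which is [(1 - t L_J) e^(t L)], differs from [P] by O(t^2).  Since [G + G^* <= 0], the matrix [1 + t G]
   is a contraction up to a factor [1 + O(t^2)], so the iterates of [P] stay bounded as long as [n t^2 <= 1], and
   telescoping gives an error O(n t^2) = O(T t) uniformly in [T].  [P] also preserves positivity and decreases the
   trace at most by a factor [1 - O(t)], which bounds the denominators of the normalized expectation from below. *)

(** * Entrywise l1 norm of complex matrices *)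

(** The obstacle is uniformity in T. The power series only yields growth bounds of the form exp(b
    T), and the l1 norm [nu] cannot see dissipativity, since already [nu 1%:M] is N. The term t^2 G
    X G^* kept in P is of the order of the error anyway and makes P a congruence, so that its
    iterates are congruences by powers of a single matrix. The jump part is never estimated over
    long times: inside exp(t L) it cancels to first order against the signed channels. Since [cfac]
    times sign times probability is affine in t, the sum over all trajectories is the n-th iterate
    of one real-linear map. *)

Lemma normr_normc (R : realType) (z : R[i]) : `|z| = (normc z)%:C.
Proof. by []. Qed.

Lemma normc_ge0 (R : realType) (z : R[i]) : 0 <= normc z.
Proof. by rewrite -ler0c -normr_normc. Qed.

Lemma ler_normcD (R : realType) (z w : R[i]) :
  normc (z + w) <= normc z + normc w.
Proof. exact: le_normcD. Qed.

Lemma normc_opp (R : realType) (z : R[i]) : normc (- z) = normc z.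
Proof. exact: normcN. Qed.

Lemma normc_conj (R : realType) (z : R[i]) : normc z^* = normc z.
Proof. by case: z => a b /=; rewrite sqrrN. Qed.

Lemma normc_real (R : realType) (x : R) : normc x%:C = `|x|.
Proof. by rewrite /= expr0n addr0 sqrtr_sqr. Qed.

Lemma normc_sum (R : realType) (I : finType) (F : I -> R[i]) :
  normc (\sum_i F i) <= \sum_i normc (F i).
Proof.
apply: (big_rec2 (fun x y => normc x <= y)) => [|i x y _ h].
  by rewrite normc0.
by apply: (le_trans (ler_normcD _ _)); apply: lerD.
Qed.

Lemma Re_le_normc (R : realType) (z : R[i]) : `|complex.Re z| <= normc z.
Proof. by rewrite -lecR -normr_normc normc_ge_Re. Qed.

Lemma Im_le_normc (R : realType) (z : R[i]) : `|complex.Im z| <= normc z.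
Proof.
case: z => a b /=; rewrite -[leLHS]sqrtr_sqr ler_sqrt ?addr_ge0 ?sqr_ge0 //.
by rewrite lerDr sqr_ge0.
Qed.

Lemma normc_le_ReIm (R : realType) (z : R[i]) :
  normc z <= `|complex.Re z| + `|complex.Im z|.
Proof.
case: z => a b /=; rewrite -[leRHS]ger0_norm ?addr_ge0 // -sqrtr_sqr.
rewrite ler_sqrt ?sqr_ge0 // sqrrD !real_normK ?num_real //.
by rewrite -addrA lerD2l lerDr mulrn_wge0 ?mulr_ge0.
Qed.

Lemma normc_sqr (R : realType) (z : R[i]) : z^* * z = (normc z ^+ 2)%:C.
Proof. by rewrite rmorphXn /= -normr_normc sqr_normc mulrC. Qed.

Lemma ReD (R : realType) (z w : R[i]) :
  complex.Re (z + w) = complex.Re z + complex.Re w.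
Proof. by case: z w => [a b] [c d]. Qed.

Lemma ReN (R : realType) (z : R[i]) : complex.Re (- z) = - complex.Re z.
Proof. by case: z. Qed.

Lemma ImD (R : realType) (z w : R[i]) :
  complex.Im (z + w) = complex.Im z + complex.Im w.
Proof. by case: z w => [a b] [c d]. Qed.

Lemma ReZ (R : realType) (a : R) (z : R[i]) :
  complex.Re (a%:C * z) = a * complex.Re z.
Proof. by case: z => b c /=; rewrite mul0r subr0. Qed.

Lemma ImZ (R : realType) (a : R) (z : R[i]) :
  complex.Im (a%:C * z) = a * complex.Im z.
Proof. by case: z => b c /=; rewrite mul0r addr0. Qed.

Lemma Re_sum (R : realType) (I : Type) (r : seq I) (F : I -> R[i]) :
  complex.Re (\sum_(i <- r) F i) = \sum_(i <- r) complex.Re (F i).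
Proof. by apply: (big_morph (@complex.Re R) (@ReD R)). Qed.

Lemma Im_sum (R : realType) (I : Type) (r : seq I) (F : I -> R[i]) :
  complex.Im (\sum_(i <- r) F i) = \sum_(i <- r) complex.Im (F i).
Proof. by apply: (big_morph (@complex.Im R) (@ImD R)). Qed.

(** This norm dominates the trace and every entry, is invariant under adjoints and is
    submultiplicative with constant 1, so errors propagate without dimension factors. *)
Definition nu (R : realType) (p q : nat) (X : 'M[R[i]]_(p, q)) : R :=
  \sum_i \sum_j normc (X i j).

Lemma nu_ge0 (R : realType) (p q : nat) (X : 'M[R[i]]_(p, q)) : 0 <= nu X.
Proof. by apply: sumr_ge0 => i _; apply: sumr_ge0 => j _; apply: normc_ge0. Qed.
#[local] Hint Resolve nu_ge0 : core.

Lemma nuD (R : realType) (p q : nat) (X Y : 'M[R[i]]_(p, q)) :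
  nu (X + Y) <= nu X + nu Y.
Proof.
rewrite -big_split; apply: ler_sum => i _; rewrite -big_split.
by apply: ler_sum => j _; rewrite mxE ler_normcD.
Qed.

Lemma nuN (R : realType) (p q : nat) (X : 'M[R[i]]_(p, q)) : nu (- X) = nu X.
Proof. by do 2!apply: eq_bigr => ? _; rewrite mxE normc_opp. Qed.

Lemma nuB (R : realType) (p q : nat) (X Y : 'M[R[i]]_(p, q)) :
  nu (X - Y) <= nu X + nu Y.
Proof. by rewrite -(nuN Y) nuD. Qed.

Lemma nuZ (R : realType) (p q : nat) (z : R[i]) (X : 'M[R[i]]_(p, q)) :
  nu (z *: X) = normc z * nu X.
Proof.
by rewrite mulr_sumr; apply: eq_bigr => i _; rewrite mulr_sumr;
  apply: eq_bigr => j _; rewrite mxE normcM.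
Qed.

Lemma nuZr (R : realType) (p q : nat) (a : R) (X : 'M[R[i]]_(p, q)) :
  0 <= a -> nu (a%:C *: X) = a * nu X.
Proof. by move=> a0; rewrite nuZ normc_real ger0_norm. Qed.

Lemma nu0 (R : realType) (p q : nat) : nu (0 : 'M[R[i]]_(p, q)) = 0.
Proof. by rewrite -(scale0r 0) nuZ normc0 mul0r. Qed.

Lemma nu_sum (R : realType) (p q : nat) (I : finType) (F : I -> 'M[R[i]]_(p, q)) :
  nu (\sum_i F i) <= \sum_i nu (F i).
Proof.
apply: (big_rec2 (fun x y => nu x <= y)) => [|i x y _ h]; first by rewrite nu0.
by apply: (le_trans (nuD _ _)); apply: lerD.
Qed.

Lemma le_nu_row (R : realType) (p q : nat) (X : 'M[R[i]]_(p, q)) (i : 'I_p) :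
  \sum_j normc (X i j) <= nu X.
Proof.
rewrite /nu (bigD1 i) //= lerDl; apply: sumr_ge0 => k _.
by apply: sumr_ge0 => j _; apply: normc_ge0.
Qed.

Lemma le_nu_entry (R : realType) (p q : nat) (X : 'M[R[i]]_(p, q))
    (i : 'I_p) (j : 'I_q) : normc (X i j) <= nu X.
Proof.
apply: le_trans _ (le_nu_row X i); rewrite (bigD1 j) //= lerDl.
by apply: sumr_ge0 => k _; apply: normc_ge0.
Qed.

Lemma nu_mul (R : realType) (p q r : nat)
    (X : 'M[R[i]]_(p, q)) (Y : 'M[R[i]]_(q, r)) : nu (X *m Y) <= nu X * nu Y.
Proof.
rewrite /nu mulr_suml; apply: ler_sum => i _.
apply: (@le_trans _ _ (\sum_l \sum_j normc (X i j) * normc (Y j l))).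
  apply: ler_sum => l _; rewrite mxE; apply: (le_trans (normc_sum _)).
  by apply: ler_sum => j _; rewrite normcM.
rewrite exchange_big mulr_suml; apply: ler_sum => j _.
by rewrite -mulr_sumr ler_wpM2l ?normc_ge0 ?le_nu_row.
Qed.

Lemma nu_dag (R : realType) (p q : nat) (X : 'M[R[i]]_(p, q)) :
  nu (X ^t*) = nu X.
Proof.
rewrite /nu exchange_big; apply: eq_bigr => i _; apply: eq_bigr => j _.
by rewrite !mxE normc_conj.
Qed.

Lemma normc_tr (R : realType) (N : nat) (X : 'M[R[i]]_N) :
  normc (\tr X) <= nu X.
Proof.
apply: (le_trans (normc_sum _)); apply: ler_sum => i _.
by rewrite (bigD1 i) //= lerDl; apply: sumr_ge0 => k _; apply: normc_ge0.
Qed.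

(** * Rules for the conjugate transpose *)

Lemma dagM (R : realType) (p q r : nat) (X : 'M[R[i]]_(p, q))
    (Y : 'M[R[i]]_(q, r)) : (X *m Y) ^t* = Y ^t* *m X ^t*.
Proof. by rewrite trmx_mul map_mxM. Qed.

Lemma dagD (R : realType) (p q : nat) (X Y : 'M[R[i]]_(p, q)) :
  (X + Y) ^t* = X ^t* + Y ^t*.
Proof. by rewrite linearD map_mxD. Qed.

Lemma dagZ (R : realType) (p q : nat) (z : R[i]) (X : 'M[R[i]]_(p, q)) :
  (z *: X) ^t* = z^* *: X ^t*.
Proof. by rewrite linearZ map_mxZ. Qed.

Lemma dagZr (R : realType) (p q : nat) (a : R) (X : 'M[R[i]]_(p, q)) :
  (a%:C *: X) ^t* = a%:C *: X ^t*.
Proof. by rewrite dagZ; congr (_ *: _); exact: (congr1 (Complex a) (@oppr0 R)). Qed.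

Lemma dagN (R : realType) (p q : nat) (X : 'M[R[i]]_(p, q)) :
  (- X) ^t* = - X ^t*.
Proof. by rewrite linearN map_mxN. Qed.

Lemma dag_sum (R : realType) (p q : nat) (I : finType)
    (F : I -> 'M[R[i]]_(p, q)) : (\sum_i F i) ^t* = \sum_i (F i) ^t*.
Proof.
by apply/matrixP => i j; rewrite !mxE !summxE rmorph_sum /=; apply: eq_bigr => k _;
  rewrite !mxE.
Qed.

Lemma dag1 (R : realType) (N : nat) : (1%:M : 'M[R[i]]_N) ^t* = 1%:M.
Proof. by rewrite trmx1 map_mx1. Qed.

Lemma dagK (R : realType) (p q : nat) (X : 'M[R[i]]_(p, q)) : X ^t* ^t* = X.
Proof. by apply/matrixP => i j; rewrite !mxE conjCK. Qed.

Lemma hermsymmx_dag (R : realType) (N : nat) (X : 'M[R[i]]_N) :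
  X \is hermsymmx -> X ^t* = X.
Proof. by move/is_hermitianmxP => {2}->; rewrite expr0 scale1r. Qed.

(** * Real-linear maps and complex series *)

(* The trajectory weights are real, so linearity over the reals is all that is needed of [evol]. *)
Definition real_linear (R : realType) (V W : lmodType R[i]) (F : V -> W) : Prop :=
  forall (a : R) (x y : V), F (a%:C *: x + y) = a%:C *: F x + F y.

Lemma real_linear0 (R : realType) (V W : lmodType R[i]) (F : V -> W) :
  real_linear F -> F 0 = 0.
Proof.
move=> hF; have := hF 1 0 0; rewrite scaler0 add0r rmorph1 scale1r => /eqP.
by rewrite -subr_eq0 opprD addNKr oppr_eq0 => /eqP.
Qed.

Lemma real_linearB (R : realType) (V W : lmodType R[i]) (F : V -> W) x y :
  real_linear F -> F (x - y) = F x - F y.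
Proof.
move=> hF; have := hF (-1) y x; rewrite rmorphN rmorph1 !scaleN1r addrC => ->.
by rewrite addrC.
Qed.

Lemma real_linear_sum (R : realType) (V W : lmodType R[i]) (F : V -> W)
    (I : finType) (a : I -> R) (x : I -> V) : real_linear F ->
  F (\sum_i (a i)%:C *: x i) = \sum_i (a i)%:C *: F (x i).
Proof.
move=> hF; apply: (big_rec2 (fun u v => F u = v)) => [|i u v _ <-].
  exact: real_linear0.
exact: hF.
Qed.

Lemma real_linear_iter (R : realType) (V : lmodType R[i]) (F : V -> V) k :
  real_linear F -> real_linear (iter k F).
Proof. by move=> hF; elim: k => [//|k ih] a x y; rewrite !iterS ih hF. Qed.

Lemma real_linear_scale (R : realType) (V W : lmodType R[i]) (F : V -> W) (t : R) :
  real_linear F -> real_linear (fun x => t%:C *: F x).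
Proof.
by move=> hF a x y; rewrite hF scalerDr !scalerA mulrC.
Qed.

Lemma real_linear_add (R : realType) (V W : lmodType R[i]) (F G : V -> W) :
  real_linear F -> real_linear G -> real_linear (fun x => F x + G x).
Proof. by move=> hF hG a x y; rewrite hF hG scalerDr addrACA. Qed.

(** [climn] has a meaningless default value on divergent sequences, so every use of linearity or of
    a bound for [csum] has to pass through such a majorant. *)
Definition summable (R : realType) (z : nat -> R[i]) : Prop :=
  exists2 v : nat -> R, cvgn (series v) & forall k, normc (z k) <= v k.

Definition csum (R : realType) (z : nat -> R[i]) : R[i] :=
  climn (fun n => \sum_(k < n) z k).

Lemma cvg_dominated (R : realType) (u v : nat -> R) :
  cvgn (series v) -> (forall k, `|u k| <= v k) -> cvgn (fun n => \sum_(k < n) u k).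
Proof.
move=> cv uv; have : cvgn (series u).
  apply: normed_cvg; apply: series_le_cvg cv => n //=.
  exact: (le_trans (normr_ge0 (u n)) (uv n)).
by rewrite /series /=; under eq_fun do rewrite big_mkord.
Qed.

Lemma summable_Re (R : realType) (z : nat -> R[i]) : summable z ->
  cvgn (fun n => complex.Re (\sum_(k < n) z k)).
Proof.
move=> [v cv zv]; under eq_fun do rewrite Re_sum.
have h k : `|complex.Re (z k)| <= v k by apply: (le_trans (Re_le_normc _)).
exact: (cvg_dominated cv h).
Qed.

Lemma summable_Im (R : realType) (z : nat -> R[i]) : summable z ->
  cvgn (fun n => complex.Im (\sum_(k < n) z k)).
Proof.
move=> [v cv zv]; under eq_fun do rewrite Im_sum.
have h k : `|complex.Im (z k)| <= v k by apply: (le_trans (Im_le_normc _)).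
exact: (cvg_dominated cv h).
Qed.

Lemma csum_linear (R : realType) (a : R) (z w : nat -> R[i]) :
  summable z -> summable w ->
  csum (fun k => a%:C * z k + w k) = a%:C * csum z + csum w.
Proof.
move=> hz hw; rewrite /csum /climn.
have e n : \sum_(k < n) (a%:C * z k + w k)
    = a%:C * (\sum_(k < n) z k) + \sum_(k < n) w k.
  by rewrite big_split mulr_sumr.
apply/eqP; rewrite eq_complex; apply/andP; split; apply/eqP.
  rewrite ReD ReZ /=; under eq_fun do rewrite e ReD ReZ.
  apply/cvg_lim => //; apply: cvgD; last exact: summable_Re.
  by apply: cvgMr; exact: summable_Re.
rewrite ImD ImZ /=; under eq_fun do rewrite e ImD ImZ.
apply/cvg_lim => //; apply: cvgD; last exact: summable_Im.
by apply: cvgMr; exact: summable_Im.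
Qed.

(** The threshold 2 matches the intended use: a partial sum contains both the constant and the
    linear term only from n = 2 on. *)
Lemma lim_dist_le (R : realType) (u : nat -> R) (a B : R) :
  cvgn u -> (forall n, (2 <= n)%N -> `|u n - a| <= B) -> `|limn u - a| <= B.
Proof.
move=> cu h; rewrite ler_distl; apply/andP; split.
  apply: limr_ge => //; exists 2%N => // n /h; rewrite ler_distl => /andP[] //.
apply: limr_le => //; exists 2%N => // n /h; rewrite ler_distl => /andP[] //.
Qed.

(** The factor 2 comes from passing to the limit separately in the real and the imaginary part. *)
Lemma csum_tail (R : realType) (z : nat -> R[i]) (B : R) : summable z ->
  (forall n, \sum_(2 <= k < n) normc (z k) <= B) ->
  normc (csum z - (z 0%N + z 1%N)) <= 2 * B.
Proof.
move=> hz h.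
have hn n : (2 <= n)%N -> normc (\sum_(k < n) z k - (z 0%N + z 1%N)) <= B.
  move=> n2; rewrite -(big_mkord xpredT) (@big_cat_nat _ _ _ 2) //= big_nat_recr //=.
  rewrite big_nat1 (addrC (z _ + _)) addrK; apply: le_trans _ (h n).
  apply: (big_rec2 (fun x y => normc x <= y)) => [|i x y _ hxy].
    by rewrite normc0.
  by apply: (le_trans (ler_normcD _ _)); apply: lerD.
apply: (le_trans (normc_le_ReIm _)); rewrite mulr_natl mulr2n; apply: lerD.
  rewrite ReD ReN; apply: lim_dist_le; first exact: summable_Re.
  by move=> n /hn; apply: le_trans; rewrite -ReN -ReD Re_le_normc.
have ImN (x : R[i]) : complex.Im (- x) = - complex.Im x by case: x.
rewrite ImD ImN; apply: lim_dist_le; first exact: summable_Im.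
by move=> n /hn; apply: le_trans; rewrite -ImN -ImD Im_le_normc.
Qed.

(** * Second-order Taylor estimate for the exponential *)

Definition bounded_by (R : realType) (N : nat)
    (F : 'M[R[i]]_N -> 'M[R[i]]_N) (b : R) : Prop :=
  forall X, nu (F X) <= b * nu X.

Definition exp_term (R : realType) (N : nat) (F : 'M[R[i]]_N -> 'M[R[i]]_N)
    (t : R) (X : 'M[R[i]]_N) (k : nat) : 'M[R[i]]_N :=
  (k`!%:R)^-1 *: iter k (fun Y => t%:C *: F Y) X.

Lemma evolE (R : realType) (N : nat) (F : 'M[R[i]]_N -> 'M[R[i]]_N)
    (t : R) (X : 'M[R[i]]_N) i j :
  evol F t X i j = csum (fun k => exp_term F t X k i j).
Proof. by rewrite mxE /csum; congr climn; apply/funext => n; rewrite summxE. Qed.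

Lemma nu_exp_term (R : realType) (N : nat) (F : 'M[R[i]]_N -> 'M[R[i]]_N)
    (b t : R) (X : 'M[R[i]]_N) (k : nat) : 0 <= t -> 0 <= b -> bounded_by F b ->
  nu (exp_term F t X k) <= exp_coeff (t * b) k * nu X.
Proof.
move=> t0 b0 hF.
have h : nu (iter k (fun Y => t%:C *: F Y) X) <= (t * b) ^+ k * nu X.
  elim: k => [|k ih]; first by rewrite expr0 mul1r.
  rewrite iterS nuZr // exprS -!mulrA ler_wpM2l //.
  by apply: (le_trans (hF _)); rewrite ler_wpM2l // mulrA.
have e : (k`!%:R)^-1 = ((k`!%:R)^-1)%:C :> R[i] by rewrite fmorphV rmorph_nat.
rewrite /exp_term e nuZr ?invr_ge0 ?ler0n // exp_coeffE /= -mulrA.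
by rewrite ler_wpM2l // invr_ge0 ler0n.
Qed.

Lemma exp_term_summable (R : realType) (N : nat)
    (F : 'M[R[i]]_N -> 'M[R[i]]_N) (b t : R) (X : 'M[R[i]]_N) i j :
  0 <= t -> 0 <= b -> bounded_by F b ->
  summable (fun k => exp_term F t X k i j).
Proof.
move=> t0 b0 hF; exists (fun k => exp_coeff (t * b) k * nu X).
  have -> : series (fun k => exp_coeff (t * b) k * nu X)
      = (fun n => series (exp_coeff (t * b)) n * nu X).
    by apply/funext => n; rewrite /series /= mulr_suml.
  by apply: is_cvgMl; apply: is_cvg_series_exp_coeff.
by move=> k; apply: le_trans (nu_exp_term _ _ _ _ hF) => //; apply: le_nu_entry.
Qed.

Lemma evol_linear (R : realType) (N : nat) (F : 'M[R[i]]_N -> 'M[R[i]]_N)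
    (b t : R) : 0 <= t -> 0 <= b -> bounded_by F b -> real_linear F ->
  real_linear (evol F t).
Proof.
move=> t0 b0 hF lF a X Y; apply/matrixP => i j; have mxlinE (U V : 'M[R[i]]_N) : (a%:C *: U + V) i j = a%:C * U i j + V i j.
  by rewrite !mxE.
apply: etrans (evolE _ _ _ _ _) _; apply: etrans _ (esym (mxlinE _ _)).
apply: etrans _ (congr2 (fun u v => a%:C * u + v)
  (esym (evolE F t X i j)) (esym (evolE F t Y i j))).
rewrite -csum_linear; try exact: exp_term_summable hF.
congr csum; apply/funext => k; rewrite /exp_term.
rewrite (real_linear_iter _ (real_linear_scale t lF)) scalerDr !mxE.
by congr (_ + _); rewrite mulrCA.
Qed.

(** For k >= 2 and t <= 1 one has t^k <= t^2; what remains is a partial sum of the exponential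
    series at b. *)
Lemma exp_term_tail (R : realType) (b t : R) (n : nat) :
  0 <= t <= 1 -> 0 <= b ->
  \sum_(2 <= k < n) exp_coeff (t * b) k <= t ^+ 2 * expR b.
Proof.
move=> /andP[t0 t1] b0.
apply: (@le_trans _ _ (\sum_(2 <= k < n) t ^+ 2 * exp_coeff b k)).
  apply: ler_sum_nat => k /andP[k2 _]; rewrite !exp_coeffE /= mulrCA.
  rewrite ler_wpM2l ?invr_ge0 ?ler0n // exprMn ler_wpM2r ?exprn_ge0 //.
  exact: ler_wiXn2l.
rewrite -mulr_sumr ler_wpM2l ?exprn_ge0 //.
apply: (@le_trans _ _ (series (exp_coeff b) n)).
  have [n2|n2] := leqP n 2.
    by rewrite big_geq //; apply: sumr_ge0 => k _; apply: exp_coeff_ge0.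
  rewrite /series /= (@big_cat_nat _ _ _ 2 0 n) //= ?(ltnW n2) // lerDr.
  by apply: sumr_ge0 => k _; apply: exp_coeff_ge0.
apply: nondecreasing_cvgn_le; last exact: is_cvg_series_exp_coeff.
by apply: nondecreasing_series => k _ _; apply: exp_coeff_ge0.
Qed.

(** Each of the N^2 entries is a series whose tail from k = 2 on is O(t^2); the constant collects
    N^2, the 2 of [csum_tail] and exp(b). *)
Lemma evol_taylor (R : realType) (N : nat) (F : 'M[R[i]]_N -> 'M[R[i]]_N)
    (b t : R) (X : 'M[R[i]]_N) : 0 <= t <= 1 -> 0 <= b -> bounded_by F b ->
  nu (evol F t X - (X + t%:C *: F X))
  <= (N%:R ^+ 2 * 2 * expR b) * t ^+ 2 * nu X.
Proof.
move=> ht b0 hF; have /andP[t0 t1] := ht.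
have h i j : normc ((evol F t X - (X + t%:C *: F X)) i j)
    <= 2 * (t ^+ 2 * expR b * nu X).
  rewrite mxE evolE mxE.
  have -> : (X + t%:C *: F X) i j = exp_term F t X 0 i j + exp_term F t X 1 i j.
    by rewrite /exp_term /= !fact0 invr1 !scale1r [LHS]mxE.
  apply: csum_tail; first exact: exp_term_summable hF.
  move=> n; apply: (@le_trans _ _ (\sum_(2 <= k < n) exp_coeff (t * b) k * nu X)).
    apply: ler_sum => k _; apply: le_trans (nu_exp_term _ _ _ _ hF) => //.
    exact: le_nu_entry.
  rewrite -mulr_suml; by apply: ler_wpM2r; [exact: nu_ge0 | exact: exp_term_tail].
apply: (@le_trans _ _ (\sum_(i < N) \sum_(j < N) 2 * (t ^+ 2 * expR b * nu X))).
  by apply: ler_sum => i _; apply: ler_sum => j _.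
rewrite !sumr_const !card_ord -(mulr_natl (_ *+ N)) -(mulr_natl (2 * _)).
by rewrite le_eqVlt; apply/orP; left; apply/eqP; ring.
Qed.

(** * Perturbation of iterates and the Hilbert-Schmidt norm *)

(** Powers of M are not known to be bounded, so the induction runs over the mixed iterates P^k M^l,
    using P^k M^(l+1) = P^(k+1) M^l + P^k (M - P) M^l. The bound B is applied to whole powers of P
    and is not raised to a power at each step. The first estimate, taken at k = 0, feeds the
    second. *)
Lemma iter_perturb_le (R : realType) (N : nat) (P M : 'M[R[i]]_N -> 'M[R[i]]_N)
    (B c : R) (n : nat) (X : 'M[R[i]]_N) : real_linear P -> 0 <= B -> 0 <= c ->
  (forall k, (k <= n)%N -> bounded_by (iter k P) B) ->
  (forall Y, nu (M Y - P Y) <= c * nu Y) ->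
  forall l k, (k + l <= n)%N ->
  nu (iter k P (iter l M X)) <= B * (1 + c * B) ^+ l * nu X /\
  nu (iter k P (iter l M X) - iter (k + l) P X)
    <= l%:R * (c * B ^+ 2 * (1 + c * B) ^+ l * nu X).
Proof.
move=> lP B0 c0 hP hM; have cB0 : 0 <= c * B by apply: mulr_ge0.
elim=> [|l ih] k kl.
  split; last by rewrite addn0 subrr nu0 mul0r.
  by rewrite expr0 mulr1; apply: hP; rewrite addn0 in kl.
have kl' : (k.+1 + l <= n)%N by rewrite addSnnS.
have [i1 i2] := ih k.+1 kl'.
have [m1 _] : nu (iter l M X) <= B * (1 + c * B) ^+ l * nu X /\ True.
  split=> //; have [] // := ih 0%N.
  by apply: leq_trans kl; rewrite add0n addnS leqW // leq_addl.
set Y := iter l M X in i1 i2 m1 *.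
have e : iter k P (iter l.+1 M X) = iter k.+1 P Y + iter k P (M Y - P Y).
  rewrite iterS -/Y real_linearB; last exact: real_linear_iter.
  by rewrite iterSr addrC subrK.
have d1 : nu (iter k P (M Y - P Y)) <= B * (c * (B * (1 + c * B) ^+ l * nu X)).
  have kn : (k <= n)%N by apply: leq_trans kl; rewrite leq_addr.
  apply: (le_trans (hP k kn _)); rewrite ler_wpM2l //.
  by apply: (le_trans (hM _)); rewrite ler_wpM2l.
have g1 : 1 <= (1 + c * B) ^+ l by rewrite exprn_ege1 // lerDl.
have X0 := nu_ge0 X.
split.
  rewrite e; apply: (le_trans (nuD _ _)); apply: (le_trans (lerD i1 d1)).
  by rewrite le_eqVlt exprS; apply/orP; left; apply/eqP; ring.
rewrite e addrAC -addSnnS; apply: (le_trans (nuD _ _)); apply: (le_trans (lerD i2 d1)).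
set Z := c * B ^+ 2 * (1 + c * B) ^+ l * nu X.
have Z0 : 0 <= Z.
  by rewrite !mulr_ge0 // ?exprn_ge0 // addr_ge0.
have -> : B * (c * (B * (1 + c * B) ^+ l * nu X)) = Z.
  by rewrite /Z expr2 !mulrA (mulrC B c).
have WZ : Z <= c * B ^+ 2 * (1 + c * B) ^+ l.+1 * nu X.
  rewrite (exprSr (1 + c * B)) (mulrA (c * B ^+ 2)) (mulrAC _ _ (nu X)) -/Z mulrDr mulr1 lerDl.
  exact: mulr_ge0.
by rewrite -natr1 mulrDl mul1r; apply: lerD => //; apply: ler_wpM2l.
Qed.

Lemma iter_perturb (R : realType) (N : nat) (P M : 'M[R[i]]_N -> 'M[R[i]]_N)
    (B c : R) (n : nat) (X : 'M[R[i]]_N) : real_linear P -> 0 <= B -> 0 <= c ->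
  (forall k, (k <= n)%N -> bounded_by (iter k P) B) ->
  (forall Y, nu (M Y - P Y) <= c * nu Y) ->
  nu (iter n M X - iter n P X)
    <= n%:R * (c * B ^+ 2 * (1 + c * B) ^+ n * nu X).
Proof.
move=> lP B0 c0 hP hM.
by have [] := iter_perturb_le X lP B0 c0 hP hM (leqnn (0 + n)).
Qed.

Lemma real_linear_mulmx (R : realType) (p q r : nat) (K : 'M[R[i]]_(p, q)) :
  real_linear (fun X : 'M[R[i]]_(q, r) => K *m X).
Proof. by move=> a X Y; rewrite mulmxDr scalemxAr. Qed.

Lemma real_linear_mulmxr (R : realType) (p q r : nat) (K : 'M[R[i]]_(q, r)) :
  real_linear (fun X : 'M[R[i]]_(p, q) => X *m K).
Proof. by move=> a X Y; rewrite mulmxDl scalemxAl. Qed.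

Lemma real_linear_chan (R : realType) (N : nat) (K : 'M[R[i]]_N) :
  real_linear (chan K).
Proof. by move=> a X Y; rewrite /chan real_linear_mulmx real_linear_mulmxr. Qed.

Lemma iter_chan (R : realType) (N : nat) (K X : 'M[R[i]]_N) k :
  iter k (chan K) X = chan (iter k (mulmx K) 1%:M) X.
Proof.
elim: k => [|k ih]; first by rewrite /chan /= dag1 mul1mx mulmx1.
by rewrite !iterS ih /chan dagM !mulmxA.
Qed.

Lemma nu_chan (R : realType) (N : nat) (K X : 'M[R[i]]_N) :
  nu (chan K X) <= nu K ^+ 2 * nu X.
Proof.
apply: (le_trans (nu_mul _ _)); rewrite nu_dag mulrC expr2 -(mulrA (nu K)).
by apply: ler_wpM2l; [exact: nu_ge0 | exact: nu_mul].
Qed.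

(** The squared Hilbert-Schmidt norm; being the trace of X^* X, it turns dissipativity into a
    sign. *)
Definition sq (R : realType) (p q : nat) (X : 'M[R[i]]_(p, q)) : R :=
  \sum_i \sum_j normc (X i j) ^+ 2.

Lemma sq_ge0 (R : realType) (p q : nat) (X : 'M[R[i]]_(p, q)) : 0 <= sq X.
Proof. by apply: sumr_ge0 => i _; apply: sumr_ge0 => j _; apply: sqr_ge0. Qed.

Lemma tr_dag_sq (R : realType) (p q : nat) (X : 'M[R[i]]_(p, q)) :
  \tr (X ^t* *m X) = (sq X)%:C.
Proof.
rewrite /sq exchange_big rmorph_sum; apply: eq_bigr => j _.
rewrite mxE rmorph_sum; apply: eq_bigr => i _.
by rewrite !mxE normc_sqr.
Qed.

Lemma entry_le_sq (R : realType) (p q : nat) (X : 'M[R[i]]_(p, q)) i j :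
  normc (X i j) ^+ 2 <= sq X.
Proof.
rewrite /sq (bigD1 i) //= (bigD1 j) //= -addrA lerDl.
apply: addr_ge0; apply: sumr_ge0 => k _; first exact: sqr_ge0.
by apply: sumr_ge0 => l _; apply: sqr_ge0.
Qed.

Lemma nu_le_sqrt_sq (R : realType) (p q : nat) (X : 'M[R[i]]_(p, q)) :
  nu X <= (p * q)%:R * Num.sqrt (sq X).
Proof.
apply: (@le_trans _ _ (\sum_(i < p) \sum_(j < q) Num.sqrt (sq X))).
  apply: ler_sum => i _; apply: ler_sum => j _.
  by rewrite -[leLHS]ger0_norm ?normc_ge0 // -sqrtr_sqr ler_sqrt ?sq_ge0 // entry_le_sq.
by rewrite !sumr_const !card_ord -mulrnA mulr_natl mulnC.
Qed.

Lemma sq_le_nu (R : realType) (p q : nat) (X : 'M[R[i]]_(p, q)) :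
  sq X <= nu X ^+ 2.
Proof.
rewrite expr2 {2}/nu mulr_sumr; apply: ler_sum => i _; rewrite mulr_sumr.
by apply: ler_sum => j _; rewrite expr2 ler_wpM2r ?normc_ge0 ?le_nu_entry.
Qed.

Lemma sq_mul (R : realType) (p q r : nat) (G : 'M[R[i]]_(p, q)) (X : 'M[R[i]]_(q, r)) :
  sq (G *m X) <= (nu G * (q * r)%:R) ^+ 2 * sq X.
Proof.
apply: (le_trans (sq_le_nu _)).
rewrite -[sq X in leRHS]sqr_sqrtr ?sq_ge0 // -exprMn.
rewrite ler_pXn2r ?nnegrE ?mulr_ge0 ?nu_ge0 ?sqrtr_ge0 ?ler0n //.
apply: (le_trans (nu_mul _ _)); rewrite -mulrA ler_wpM2l ?nu_ge0 //.
exact: nu_le_sqrt_sq.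
Qed.

(** Expanding the square gives |X|^2 + t tr(X^* (G^* + G) X) + t^2 |G X|^2, whose middle term is
    nonpositive; only second-order growth survives. *)
Lemma sq_euler_step (R : realType) (N q : nat) (G : 'M[R[i]]_N) (t : R)
    (X : 'M[R[i]]_(N, q)) :
  0 <= t -> complex.Re (\tr (X ^t* *m (G ^t* + G) *m X)) <= 0 ->
  sq ((1%:M + t%:C *: G) *m X) <= (1 + (nu G * (N * q)%:R) ^+ 2 * t ^+ 2) * sq X.
Proof.
move=> t0 hG.
have e : (sq ((1%:M + t%:C *: G) *m X))%:C
    = (sq X)%:C + t%:C * \tr (X ^t* *m (G ^t* + G) *m X)
      + (t ^+ 2 * sq (G *m X))%:C.
  rewrite rmorphM rmorphXn /= -!tr_dag_sq -!mxtraceZ -!mxtraceD; congr (\tr _).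
  rewrite mulmxDl mul1mx -scalemxAl dagD dagZr mulmxDl !mulmxDr -!scalemxAl.
  rewrite -!scalemxAr scalerA -expr2 dagM mulmxDl scalerDr !addrA -!mulmxA.
  have swap (a b c e : 'M[R[i]]_q) : a + b + c + e = a + c + b + e.
    by rewrite (addrAC a).
  exact: swap.
have -> : sq ((1%:M + t%:C *: G) *m X)
    = sq X + t * complex.Re (\tr (X ^t* *m (G ^t* + G) *m X)) + t ^+ 2 * sq (G *m X).
  by rewrite -[LHS]/(complex.Re (_%:C)) e !ReD ReZ.
rewrite mulrDl mul1r; apply: lerD.
  by rewrite gerDl mulr_ge0_le0.
by rewrite mulrC [leRHS]mulrAC ler_wpM2r ?exprn_ge0 // sq_mul.
Qed.

(** * Boundedness and positivity of the Euler map *)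

Lemma expr1D_le_expR (R : realType) (x : R) (k : nat) :
  0 <= x -> (1 + x) ^+ k <= expR (k%:R * x).
Proof.
move=> x0; rewrite expRM_natl; apply: lerXn2r; last exact: expR_ge1Dx.
by rewrite nnegrE addr_ge0.
 by rewrite nnegrE expR_ge0.
Qed.

(** On [0, 1/2], 1 <= (1 - x)(1 + 2x) <= (1 - x) exp(2x), because the first product equals 1 + x (1
    - 2x). *)
Lemma expr1B_ge_expR (R : realType) (x : R) (k : nat) :
  0 <= x <= 2^-1 -> expR (- (k%:R * (2 * x))) <= (1 - x) ^+ k.
Proof.
move=> /andP[x0 x1]; rewrite -mulrN expRM_natl.
have x1' : 0 <= 1 - x by lra.
apply: lerXn2r; rewrite ?nnegrE ?expR_ge0 // expRN -[leRHS]mul1r.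
rewrite -[leLHS]mul1r ler_pdivrMr ?expR_gt0 // mul1r.
apply: (@le_trans _ _ ((1 - x) * (1 + 2 * x))); first by nra.
by rewrite ler_wpM2l // expR_ge1Dx.
Qed.

(** The condition G + G^* <= 0, tested on square matrices instead of vectors because it is applied
    to the powers of 1 + t G. *)
Definition dissipative (R : realType) (N : nat) (G : 'M[R[i]]_N) : Prop :=
  forall X : 'M[R[i]]_N, complex.Re (\tr (X ^t* *m (G ^t* + G) *m X)) <= 0.

(** The k-th iterate is the congruence by (1 + t G)^k, whose squared Hilbert-Schmidt norm is at most
    (1 + c t^2)^k <= exp(c k t^2) <= exp(c) times that of the identity. *)
Lemma iter_chan_bound (R : realType) (N : nat) (G : 'M[R[i]]_N) :
  dissipative G -> exists2 B : R, 0 <= B &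
  forall (t : R) k, 0 <= t -> k%:R * t ^+ 2 <= 1 ->
    bounded_by (iter k (chan (1%:M + t%:C *: G))) B.
Proof.
move=> hG; set c := (nu G * (N * N)%:R) ^+ 2.
have c0 : 0 <= c by apply: sqr_ge0.
set B := (N * N)%:R * Num.sqrt (expR c * sq (1%:M : 'M[R[i]]_N)).
(* A congruence contains the power twice, hence the square. *)
exists (B ^+ 2); first exact: sqr_ge0.
move=> t k t0 kt X; rewrite iter_chan.
set K := 1%:M + _; set Kk := iter k _ _.
have sK : sq Kk <= expR c * sq (1%:M : 'M[R[i]]_N).
  have h : sq Kk <= (1 + c * t ^+ 2) ^+ k * sq (1%:M : 'M[R[i]]_N).
    rewrite /Kk; elim: (k) => [|l ih]; first by rewrite expr0 mul1r.
    rewrite iterS (exprS (1 + _)) -mulrA; apply: (le_trans (sq_euler_step t0 (hG _))).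
    by apply: ler_wpM2l => //; rewrite addr_ge0 // mulr_ge0 // sqr_ge0.
  apply: (le_trans h); apply: ler_wpM2r; first exact: sq_ge0.
  have ct : 0 <= c * t ^+ 2 by rewrite mulr_ge0 // sqr_ge0.
  apply: (le_trans (expr1D_le_expR _ ct)); rewrite ler_expR mulrCA.
  by rewrite -[leRHS]mulr1 ler_wpM2l.
apply: (le_trans (nu_chan _ _)); apply: ler_wpM2r; first exact: nu_ge0.
have B0 : 0 <= B by rewrite mulr_ge0 ?ler0n ?sqrtr_ge0.
rewrite ler_pXn2r ?nnegrE ?nu_ge0 //; apply: (le_trans (nu_le_sqrt_sq _)).
by rewrite ler_wpM2l ?ler0n // ler_wsqrtr.
Qed.

Lemma psd_chan (R : realType) (N : nat) (K X : 'M[R[i]]_N) :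
  psd X -> psd (chan K X).
Proof.
move=> hX v; have := hX (K ^t* *m v); rewrite dagM dagK /chan.
by rewrite !mulmxA.
Qed.

(** This is the quadratic form of X at e_a + z e_b. The conjugate of z is a separate variable so
    that it can be supplied in a convenient closed form. *)
Lemma psd_entry2 (R : realType) (N : nat) (X : 'M[R[i]]_N) (a b : 'I_N) (z w : R[i]) :
  psd X -> w = z^* -> 0 <= X a a + z * X a b + w * X b a + w * z * X b b.
Proof.
move=> hX ->; have := hX (delta_mx a 0 + z *: delta_mx b 0).
rewrite dagD dagZ.
have hd (c : 'I_N) : (delta_mx c 0 : 'cV[R[i]]_N) ^t* = delta_mx 0 c.
  by rewrite trmx_delta map_delta_mx.
have he (c e : 'I_N) : (delta_mx 0 c : 'rV[R[i]]_N) *m X *m delta_mx e 0 = (X c e)%:M.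
  by rewrite -rowE -colE; apply/matrixP => i j; rewrite !ord1 !mxE eqxx mulr1n.
rewrite !hd !mulmxDl !mulmxDr -!scalemxAl -!scalemxAr !he !mxE !eqxx !mulr1n.
by rewrite !addrA !mulrA.
Qed.

Lemma psd_diag_ge0 (R : realType) (N : nat) (X : 'M[R[i]]_N) (a : 'I_N) :
  psd X -> 0 <= X a a.
Proof.
move=> hX; have := hX (delta_mx a 0).
rewrite trmx_delta map_delta_mx -rowE -colE.
by rewrite !mxE.
Qed.

Lemma psd_tr_ge0 (R : realType) (N : nat) (X : 'M[R[i]]_N) : psd X -> 0 <= \tr X.
Proof. by move=> hX; apply: sumr_ge0 => a _; apply: psd_diag_ge0. Qed.

Lemma Re_tr_ge0 (R : realType) (N : nat) (X : 'M[R[i]]_N) :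
  psd X -> 0 <= complex.Re (\tr X).
Proof. by move/psd_tr_ge0; rewrite lecE => /andP[]. Qed.

(* Positivity of the 2x2 principal minors, tested on e_a + z e_b with the phase z chosen so that z X_ab = -|X_ab|. *)
Lemma psd_entry_le_tr (R : realType) (N : nat) (X : 'M[R[i]]_N) (a b : 'I_N) :
  psd X -> normc (X a b) <= complex.Re (\tr X).
Proof.
move=> hX.
have d0 c : 0 <= complex.Re (X c c).
  by have := psd_diag_ge0 c hX; rewrite lecE => /andP[].
have dn c : normc (X c c) = complex.Re (X c c).
  by rewrite -[LHS]/(complex.Re (normc (X c c))%:C) -normr_normc ger0_norm // psd_diag_ge0.
have trE : complex.Re (\tr X) = \sum_c complex.Re (X c c) by rewrite Re_sum.
have [<-|ab] := eqVneq a b.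
  by rewrite dn trE (bigD1 a) //= lerDl; apply: sumr_ge0 => c _.
have h : complex.Re (X a a) + complex.Re (X b b) <= complex.Re (\tr X).
  rewrite trE (bigD1 a) //= lerD2l (bigD1 b) //=; last by rewrite eq_sym.
  by rewrite lerDl; apply: sumr_ge0 => c _.
(* [psd] does not include Hermitian symmetry; it follows from the vanishing imaginary parts of the
   form at z = 1 and z = i. *)
have herm : X b a = (X a b)^*.
  have := psd_entry2 a b hX (erefl (1 : R[i])^*).
  have := psd_entry2 a b hX (erefl ('i%C)^*).
  have := psd_diag_ge0 a hX; have := psd_diag_ge0 b hX.
  rewrite !lecE; case: (X a a) (X b b) (X a b) (X b a) => [a1 a2] [b1 b2] [c1 c2] [e1 e2].
  move=> /andP[/eqP /= hb _] /andP[/eqP /= ha _] /andP[/eqP /= h1 _] /andP[/eqP /= h2 _].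
  by apply/eqP; rewrite eq_complex /=; apply/andP; split; apply/eqP; lra.
have [x0|x0] := eqVneq (X a b) 0.
  by rewrite x0 normc0; apply: le_trans h; apply: addr_ge0.
have n0 : normc (X a b) != 0 by apply: contra_neq x0 => /eq0_normc.
pose r := normc (X a b); rewrite -/r in n0 *.
have rc0 : r%:C != 0 :> R[i] by rewrite (inj_eq (@complexI R)).
have cj : - (X a b / r%:C) = (- ((X a b)^* / r%:C))^*.
  rewrite -fmorphV; case: (X a b) => u v.
  by apply/eqP; rewrite eq_complex /=; apply/andP; split; apply/eqP; ring.
have := psd_entry2 a b hX cj.
have e1 : - ((X a b)^* / r%:C) * X a b = - r%:C.
  by rewrite mulNr mulrAC normc_sqr -/r rmorphXn /= expr2 mulfK.
have e2 : - (X a b / r%:C) * X b a = - r%:C.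
  by rewrite herm mulNr mulrAC (mulrC (X a b)) normc_sqr -/r rmorphXn /= expr2 mulfK.
have e3 : - (X a b / r%:C) * (- ((X a b)^* / r%:C)) = 1.
  rewrite mulrNN mulf_div (mulrC (X a b)) normc_sqr -/r -rmorphM -expr2 divff //.
  by rewrite (inj_eq (@complexI R)) expf_neq0.
(* The form becomes X_aa + X_bb - 2 |X_ab| >= 0. *)
rewrite e1 e2 e3 mul1r lecE => /andP[_].
rewrite !ReD !ReN /= => h2; have := normc_ge0 (X a b); rewrite -/r => r0.
by apply: le_trans h; lra.
Qed.

(** * The non-Hermitian generator *)

(** Lets the loss of trace in one step be measured relative to the trace itself, so that the
    one-step bounds multiply. *)
Lemma nu_le_tr_psd (R : realType) (N : nat) (X : 'M[R[i]]_N) :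
  psd X -> nu X <= (N * N)%:R * complex.Re (\tr X).
Proof.
move=> hX.
apply: (@le_trans _ _ (\sum_(i < N) \sum_(j < N) complex.Re (\tr X))).
  by apply: ler_sum => i _; apply: ler_sum => j _; apply: psd_entry_le_tr.
by rewrite !sumr_const !card_ord -mulrnA mulr_natl.
Qed.

Lemma chan_eulerE (R : realType) (N : nat) (G X : 'M[R[i]]_N) (t : R) :
  chan (1%:M + t%:C *: G) X
  = X + t%:C *: (G *m X + X *m G ^t*) + (t ^+ 2)%:C *: chan G X.
Proof.
rewrite /chan dagD dagZr dag1 mulmxDl mul1mx !mulmxDr !mulmx1 !mulmxDl.
rewrite -!scalemxAl -!scalemxAr scalerA -expr2 -rmorphXn scalerDr -!addrA.
by congr (_ + _); rewrite -!scalemxAl scalerA -expr2 -rmorphXn.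
Qed.

Lemma tr_chan_euler_ge (R : realType) (N : nat) (G X : 'M[R[i]]_N) (t : R) :
  0 <= t -> psd X ->
  (1 - 2 * nu G * (N * N)%:R * t) * complex.Re (\tr X)
  <= complex.Re (\tr (chan (1%:M + t%:C *: G) X)).
Proof.
move=> t0 hX; rewrite chan_eulerE !mxtraceD !mxtraceZ !ReD !ReZ.
have h1 := Re_tr_ge0 (psd_chan G hX).
have h2 : - (2 * nu G * (N * N)%:R * complex.Re (\tr X))
    <= complex.Re (\tr (G *m X + X *m G ^t*)).
  rewrite lerNl -ReN; apply: (le_trans (ler_norm _)).
  apply: (le_trans (Re_le_normc _)); rewrite normc_opp.
  apply: (le_trans (normc_tr _)); apply: (le_trans (nuD _ _)).
  apply: (@le_trans _ _ (2 * nu G * nu X)).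
    rewrite -mulrA mulr_natl mulr2n; apply: lerD; first exact: nu_mul.
    by apply: (le_trans (nu_mul _ _)); rewrite nu_dag mulrC.
  rewrite -[leRHS]mulrA; apply: ler_wpM2l; last exact: nu_le_tr_psd.
  by apply: mulr_ge0 => //; apply: nu_ge0.
have h3 := ler_wpM2l t0 h2.
have h4 : 0 <= t ^+ 2 * complex.Re (\tr (chan G X)).
  by apply: mulr_ge0 h1; apply: sqr_ge0.
have -> : (1 - 2 * nu G * (N * N)%:R * t) * complex.Re (\tr X)
  = complex.Re (\tr X) + t * - (2 * nu G * (N * N)%:R * complex.Re (\tr X)).
  by ring.
move: h3 h4; rewrite mxtraceD ReD; lra.
Qed.

Lemma psd_iter_chan (R : realType) (N : nat) (K X : 'M[R[i]]_N) k :
  psd X -> psd (iter k (chan K) X).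
Proof. by move=> hX; elim: k => [//|k ih]; rewrite iterS; apply: psd_chan. Qed.

(** Starting from trace 1, the one-step bound is iterated along the positive matrices P^k X. The
    condition c t <= 1/2 keeps the factor 1 - c t nonnegative and allows its comparison with exp(-2
    c t). *)
Lemma tr_iter_chan_ge (R : realType) (N : nat) (G : 'M[R[i]]_N) :
  exists2 c : R, 0 <= c & forall (X : 'M[R[i]]_N) (t : R) k,
    0 <= t -> c * t <= 2^-1 -> density X ->
    expR (- (k%:R * (2 * (c * t))))
    <= complex.Re (\tr (iter k (chan (1%:M + t%:C *: G)) X)).
Proof.
exists (2 * nu G * (N * N)%:R).
  by rewrite !mulr_ge0 ?ler0n //; apply: nu_ge0.
set c := _ * _; have c0 : 0 <= c by rewrite !mulr_ge0 ?ler0n //; apply: nu_ge0.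
move=> X t k t0 ct [pX tX].
have ct0 : 0 <= c * t by apply: mulr_ge0.
apply: (@le_trans _ _ ((1 - c * t) ^+ k)).
  by apply: expr1B_ge_expR; apply/andP.
elim: k => [|k ih]; first by rewrite expr0 /= tX.
rewrite iterS exprS; apply: le_trans (tr_chan_euler_ge G t0 (psd_iter_chan _ k pX)).
by apply: ler_wpM2l => //; lra.
Qed.

Definition nh_gen (R : realType) (N : nat) (E : finType) (HRe : 'M[R[i]]_N)
    (HI : E -> 'M[R[i]]_N) (gamma : E -> R) : 'M[R[i]]_N :=
  - ('i *: HRe) - \sum_l (gamma l)%:C *: (HI l *m HI l).

Lemma dag_nh_gen (R : realType) (N : nat) (E : finType) (HRe : 'M[R[i]]_N)
    (HI : E -> 'M[R[i]]_N) (gamma : E -> R) :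
  HRe \is hermsymmx -> (forall l, HI l \is hermsymmx) ->
  (nh_gen HRe HI gamma) ^t*
  = 'i *: HRe - \sum_l (gamma l)%:C *: (HI l *m HI l).
Proof.
move=> hH hI; rewrite /nh_gen dagD !dagN dagZ dag_sum hermsymmx_dag //.
congr (_ - _).
  rewrite -scaleNr; congr (_ *: _).
  by apply/eqP; rewrite eq_complex /= oppr0 opprK !eqxx.
by apply: eq_bigr => l _; rewrite dagZr dagM hermsymmx_dag.
Qed.

Lemma LNHE (R : realType) (N : nat) (E : finType) (HRe : 'M[R[i]]_N)
    (HI : E -> 'M[R[i]]_N) (gamma : E -> R) (X : 'M[R[i]]_N) :
  HRe \is hermsymmx -> (forall l, HI l \is hermsymmx) ->
  LNH HRe HI gamma X
  = nh_gen HRe HI gamma *m X + X *m (nh_gen HRe HI gamma) ^t*.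
Proof.
move=> hH hI; rewrite dag_nh_gen // /nh_gen /LNH /comm /acomm.
rewrite mulmxBl mulmxBr mulNmx -scalemxAl -scalemxAr mulmx_suml mulmx_sumr.
rewrite scalerBr opprB addrACA -opprD -big_split /= [X in X - _]addrC.
by congr (_ - _); apply: eq_bigr => l _; rewrite -scalemxAl -scalemxAr scalerDr.
Qed.

Lemma mxtrace_sum (R : realType) (N : nat) (I : finType) (F : I -> 'M[R[i]]_N) :
  \tr (\sum_i F i) = \sum_i \tr (F i).
Proof. exact: (raddf_sum (@mxtrace _ N)). Qed.

(** In G + G^* the Hamiltonian part cancels. What is left is minus twice a positive combination of
    squares, and the trace of X^* H_l^2 X is the squared norm of H_l X. *)
Lemma nh_gen_dissipative (R : realType) (N : nat) (E : finType) (HRe : 'M[R[i]]_N)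
    (HI : E -> 'M[R[i]]_N) (gamma : E -> R) :
  HRe \is hermsymmx -> (forall l, HI l \is hermsymmx) -> (forall l, 0 < gamma l) ->
  dissipative (nh_gen HRe HI gamma).
Proof.
move=> hH hI hg X; rewrite dag_nh_gen // /nh_gen addrACA subrr add0r -opprD.
rewrite mulmxN mulNmx raddfN ReN oppr_le0 mulmxDr mulmxDl raddfD /=.
have h : 0 <= complex.Re
    (\tr (X ^t* *m (\sum_l (gamma l)%:C *: (HI l *m HI l)) *m X)).
  rewrite mulmx_sumr mulmx_suml mxtrace_sum Re_sum; apply: sumr_ge0 => l _.
  rewrite -scalemxAr -scalemxAl mxtraceZ ReZ.
  have -> : X ^t* *m (HI l *m HI l) *m X = (HI l *m X) ^t* *m (HI l *m X).
    by rewrite dagM (hermsymmx_dag (hI l)) !mulmxA.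
  by rewrite tr_dag_sq mulr_ge0 ?sq_ge0 // ltW.
by rewrite ReD addr_ge0.
Qed.

(** * Bounded superoperators *)

Definition bounded (R : realType) (N : nat) (F : 'M[R[i]]_N -> 'M[R[i]]_N) : Prop :=
  exists2 b, 0 <= b & bounded_by F b.

Lemma bounded_sandwich (R : realType) (N : nat) (A B : 'M[R[i]]_N) :
  bounded (fun X => A *m X *m B).
Proof.
exists (nu A * nu B); first by apply: mulr_ge0; apply: nu_ge0.
move=> X; apply: (le_trans (nu_mul _ _)); rewrite mulrAC.
by apply: ler_wpM2r; [exact: nu_ge0 | exact: nu_mul].
Qed.

Lemma boundedD (R : realType) (N : nat) (F G : 'M[R[i]]_N -> 'M[R[i]]_N) :
  bounded F -> bounded G -> bounded (fun X => F X + G X).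
Proof.
move=> [b b0 hb] [c c0 hc]; exists (b + c); first exact: addr_ge0.
by move=> X; rewrite mulrDl; apply: (le_trans (nuD _ _)); apply: lerD.
Qed.

Lemma boundedZ (R : realType) (N : nat) (F : 'M[R[i]]_N -> 'M[R[i]]_N) z :
  bounded F -> bounded (fun X => z *: F X).
Proof.
move=> [b b0 hb]; exists (normc z * b); first by rewrite mulr_ge0 ?normc_ge0.
by move=> X; rewrite nuZ -mulrA ler_wpM2l ?normc_ge0.
Qed.

Lemma bounded_sum (R : realType) (N : nat) (I : finType)
    (F : I -> 'M[R[i]]_N -> 'M[R[i]]_N) :
  (forall i, bounded (F i)) -> bounded (fun X => \sum_i F i X).
Proof.
move=> h; have /boolp.choice[b hb] : forall i, exists c, 0 <= c /\ bounded_by (F i) c.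
  by move=> i; have [c c0 hc] := h i; exists c.
exists (\sum_i b i); first by apply: sumr_ge0 => i _; case: (hb i).
move=> X; apply: (le_trans (nu_sum _)); rewrite mulr_suml.
by apply: ler_sum => i _; case: (hb i) => _; apply.
Qed.

Lemma eq_bounded (R : realType) (N : nat) (F G : 'M[R[i]]_N -> 'M[R[i]]_N) :
  F =1 G -> bounded F -> bounded G.
Proof. by move=> e [b b0 hb]; exists b => // X; rewrite -e. Qed.

Lemma LJ_bounded (R : realType) (N : nat) (E : finType)
    (HI : E -> 'M[R[i]]_N) (gamma : E -> R) : bounded (LJ HI gamma).
Proof. by apply: bounded_sum => l; apply: boundedZ; apply: bounded_sandwich. Qed.

Lemma LJ_linear (R : realType) (N : nat) (E : finType)
    (HI : E -> 'M[R[i]]_N) (gamma : E -> R) : real_linear (LJ HI gamma).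
Proof.
move=> a X Y; rewrite /LJ scaler_sumr -big_split; apply: eq_bigr => l _ /=.
rewrite mulmxDr mulmxDl -scalemxAr -scalemxAl scalerDr !scalerA.
by rewrite (mulrC a%:C).
Qed.

Lemma LNH_bounded (R : realType) (N : nat) (E : finType) (HRe : 'M[R[i]]_N)
    (HI : E -> 'M[R[i]]_N) (gamma : E -> R) :
  HRe \is hermsymmx -> (forall l, HI l \is hermsymmx) ->
  bounded (LNH HRe HI gamma).
Proof.
move=> hH hI; set G := nh_gen HRe HI gamma.
apply: (@eq_bounded _ _ (fun X => G *m X *m 1%:M + 1%:M *m X *m G ^t*)).
  by move=> X; rewrite mulmx1 mul1mx LNHE.
by apply: boundedD; apply: bounded_sandwich.
Qed.

Lemma LNH_linear (R : realType) (N : nat) (E : finType) (HRe : 'M[R[i]]_N)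
    (HI : E -> 'M[R[i]]_N) (gamma : E -> R) :
  HRe \is hermsymmx -> (forall l, HI l \is hermsymmx) ->
  real_linear (LNH HRe HI gamma).
Proof.
move=> hH hI a X Y; rewrite !LNHE //; move: (nh_gen _ _ _) => G.
rewrite mulmxDr mulmxDl -scalemxAr -scalemxAl.
by rewrite addrACA -scalerDr.
Qed.

(** * The signed average over trajectories *)

Lemma big_option (V : nmodType) (T : finType) (F : option T -> V) :
  \sum_s F s = F None + \sum_x F (Some x).
Proof.
rewrite (bigD1 None) //=; congr (_ + _).
rewrite (reindex_omap Some id) //=; last by case.
by apply: eq_bigl => x; rewrite eqxx.
Qed.

Lemma big_tuple_cons (V : nmodType) (T : finType) (n : nat)
    (F : n.+1.-tuple T -> V) :
  \sum_js F js = \sum_s \sum_(js : n.-tuple T) F [tuple of s :: js].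
Proof.
rewrite pair_big /= (reindex (fun p : T * n.-tuple T => [tuple of p.1 :: p.2])) //=.
exists (fun js : n.+1.-tuple T => (thead js, [tuple of behead js])).
  by move=> [s js] _; congr (_, _); apply: val_inj.
by move=> js _; rewrite [RHS]tuple_eta.
Qed.

(** The coefficient of the channel [s] when the identity minus dt times the jump part is
    expanded. *)
Definition weight (R : realType) (E : finType) (m : E -> nat)
    (q0 : R) (q : forall l : E, 'I_(m l) -> R) (dt : R) (s : step m) : R :=
  if s is Some lj then q (tag lj) (tagged lj) * dt else 1 + q0 * dt.

Lemma sign_prob_weight (R : realType) (E : finType) (m : E -> nat)
    (q0 : R) (q : forall l : E, 'I_(m l) -> R) (dt : R) (s : step m) :
  cfac q0 q dt != 0 ->
  cfac q0 q dt * (sign q s * prob q0 q dt s) = weight q0 q dt s.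
Proof.
move=> c0; case: s => [lj|] /=; last by rewrite mul1r mulrC divfK.
by rewrite [in RHS](numEsg (q _ _)); field.
Qed.

Definition mean_step (R : realType) (S : finType) (d : S -> nat) (E : finType)
    (supp : E -> {set S}) (m : E -> nat)
    (A : forall l : E, 'I_(m l) -> lop R d (supp l))
    (L : op R d -> op R d) (q0 : R) (q : forall l : E, 'I_(m l) -> R)
    (dt : R) (rho : op R d) : op R d :=
  \sum_s (weight q0 q dt s)%:C *: stepchan A s (evol L dt rho).

Lemma stepchan_linear (R : realType) (S : finType) (d : S -> nat) (E : finType)
    (supp : E -> {set S}) (m : E -> nat)
    (A : forall l : E, 'I_(m l) -> lop R d (supp l)) (s : step m) :
  real_linear (stepchan A s).
Proof. by case: s => [lj|] //=; apply: real_linear_chan. Qed.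

Lemma mean_step_linear (R : realType) (S : finType) (d : S -> nat) (E : finType)
    (supp : E -> {set S}) (m : E -> nat)
    (A : forall l : E, 'I_(m l) -> lop R d (supp l))
    (L : op R d -> op R d) (q0 : R) (q : forall l : E, 'I_(m l) -> R) (dt : R) :
  real_linear (evol L dt) -> real_linear (mean_step A L q0 q dt).
Proof.
move=> lL a X Y; rewrite /mean_step scaler_sumr -big_split; apply: eq_bigr => s _ /=.
by rewrite lL stepchan_linear scalerDr !scalerA mulrC.
Qed.

(** Induction with the initial state generalized, since a trajectory consumes its first index first:
    real linearity of the remaining steps pulls the sum over that index out of them. *)
Lemma sum_traj (R : realType) (S : finType) (d : S -> nat) (E : finType)
    (supp : E -> {set S}) (m : E -> nat)
    (A : forall l : E, 'I_(m l) -> lop R d (supp l))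
    (L : op R d -> op R d) (q0 : R) (q : forall l : E, 'I_(m l) -> R)
    (dt : R) (n : nat) (rho : op R d) : real_linear (evol L dt) ->
  \sum_(js : n.-tuple (step m))
    (\prod_(k < n) weight q0 q dt (tnth js k))%:C *: traj A L dt js rho
  = iter n (mean_step A L q0 q dt) rho.
Proof.
move=> lL; elim: n rho => [|n ih] rho.
  rewrite (bigD1 [tuple]) //= big_ord0 scale1r big1 ?addr0 // => js.
  by rewrite (tuple0 js) => /eqP.
rewrite iterSr {2}/mean_step real_linear_sum; last first.
  by apply: real_linear_iter; apply: mean_step_linear.
rewrite big_tuple_cons; apply: eq_bigr => s _; rewrite -ih scaler_sumr.
apply: eq_bigr => js _; rewrite scalerA -rmorphM big_ord_recl tnth0.
by congr (_%:C *: _); congr (_ * _); apply: eq_bigr => k _; rewrite tnthS.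
Qed.

Lemma cfac_signed_avg (R : realType) (S : finType) (d : S -> nat) (E : finType)
    (supp : E -> {set S}) (m : E -> nat)
    (A : forall l : E, 'I_(m l) -> lop R d (supp l))
    (L : op R d -> op R d) (q0 : R) (q : forall l : E, 'I_(m l) -> R)
    (dt : R) (n : nat) (rho Obs : op R d) :
  real_linear (evol L dt) -> cfac q0 q dt != 0 ->
  (cfac q0 q dt ^+ n)%:C * signed_avg A L q0 q dt n rho Obs
  = \tr (Obs *m iter n (mean_step A L q0 q dt) rho).
Proof.
move=> lL c0; rewrite -sum_traj // mulmx_sumr mxtrace_sum mulr_sumr.
apply: eq_bigr => js _; rewrite -scalemxAr mxtraceZ mulrA; congr (_ * _).
rewrite -!rmorphM /= -big_split /= -[X in _ ^+ X](card_ord n) -prodr_const.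
by rewrite -big_split; congr (_%:C); apply: eq_bigr => k _; apply: sign_prob_weight.
Qed.

(** The 1 in the weight 1 + q0 dt reproduces the evolved state, and the terms proportional to dt
    reassemble the expansion of minus the jump part. *)
Lemma mean_stepE (R : realType) (S : finType) (d : S -> nat) (E : finType)
    (supp : E -> {set S}) (m : E -> nat)
    (A : forall l : E, 'I_(m l) -> lop R d (supp l))
    (HI : E -> op R d) (gamma : E -> R)
    (L : op R d -> op R d) (q0 : R) (q : forall l : E, 'I_(m l) -> R)
    (dt : R) (rho : op R d) : expansion A HI gamma q0 q ->
  mean_step A L q0 q dt rho
  = evol L dt rho - dt%:C *: LJ HI gamma (evol L dt rho).
Proof.
move=> hq; rewrite /mean_step big_option /= -scalerN hq.
set Y := evol L dt rho.
rewrite rmorphD rmorph1 scalerDl scale1r -addrA; congr (_ + _).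
rewrite scalerDr scalerA -rmorphM (mulrC dt); congr (_ + _).
rewrite sig_big_dep /= scaler_sumr; apply: eq_bigr => lj _.
by rewrite scalerA -rmorphM mulrC.
Qed.

(** * Existence of the expansion *)

Lemma chan_entry (R : realType) (N : nat) (A X : 'M[R[i]]_N) (a b : 'I_N) :
  chan A X a b = \sum_l \sum_k A a k * (A b l)^* * X k l.
Proof.
rewrite /chan mxE; apply: eq_bigr => l _; rewrite !mxE mulr_suml.
by apply: eq_bigr => k _; rewrite mulrAC.
Qed.

(** Matrix units read off the tensor A_aa' conj(A_bb'), turning a relation between superoperators
    into one between numbers. *)
Lemma chan_delta (R : realType) (N : nat) (A : 'M[R[i]]_N) (a b a' b' : 'I_N) :
  chan A (delta_mx a' b') a b = A a a' * (A b b')^*.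
Proof.
rewrite chan_entry (bigD1 b') //= (bigD1 a') //= mxE !eqxx mulr1.
rewrite big1 ?addr0 => [|k /negPf kn]; last by rewrite mxE kn mulr0.
rewrite big1 ?addr0 // => l /negPf ln; apply: big1 => k _.
by rewrite mxE ln andbF mulr0.
Qed.

(* Hermiticity preservation makes the conjugated coefficients equally valid, so their average is real. *)
Lemma chan_span_real (R : realType) (N m : nat) (A : 'I_m -> 'M[R[i]]_N)
    (h : 'M[R[i]]_N) : chan_span A ->
  exists r : 'I_m -> R, forall a b a' b',
    h a a' * (h b b')^* = \sum_j (r j)%:C * (A j a a' * (A j b b')^*).
Proof.
move=> hA; have [c hc] := hA (mulmxr (h ^t*) \o mulmx h).
have h1 a b a' b' :
    h a a' * (h b b')^* = \sum_j c j * (A j a a' * (A j b b')^*).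
  rewrite -chan_delta -[chan _ _]/((mulmxr (h ^t*) \o mulmx h) (delta_mx a' b')) hc.
  by rewrite summxE; apply: eq_bigr => j _; rewrite mxE chan_delta.
exists (fun j => complex.Re (c j)) => a b a' b'.
(* Conjugating while exchanging (a, a') with (b, b') leaves every such product unchanged and only
   conjugates the coefficients. *)
have h2 : h a a' * (h b b')^* = \sum_j (c j)^* * (A j a a' * (A j b b')^*).
  have := congr1 (@conjc R) (h1 b a b' a').
  rewrite rmorphM /= conjcK mulrC => ->; rewrite rmorph_sum; apply: eq_bigr => j _.
  by rewrite !rmorphM /= conjcK (mulrC (A j a a')).
have n2 : 2%:R != 0 :> R[i] by rewrite pnatr_eq0.
apply: (mulfI n2); rewrite mulr_natl mulr2n {1}h1 h2 -big_split mulr_sumr.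
by apply: eq_bigr => j _ /=; rewrite -mulrDl addcJ -mulrA.
Qed.

(** An entry of an embedded operator is a local entry or 0, according to a condition on
    configurations that is the same for all operators. The local tensor identity therefore lifts
    entry by entry. *)
Lemma chan_embed_combination (R : realType) (S : finType) (d : S -> nat)
    (X : {set S}) (m : nat) (A : 'I_m -> lop R d X) (h : lop R d X)
    (r : 'I_m -> R) :
  (forall a b a' b',
    h a a' * (h b b')^* = \sum_j (r j)%:C * (A j a a' * (A j b b')^*)) ->
  forall rho : op R d,
  chan (embed h) rho = \sum_j (r j)%:C *: chan (embed (A j)) rho.
Proof.
move=> hr rho; apply/matrixP => a b; rewrite summxE chan_entry.
under [RHS]eq_bigr do rewrite mxE chan_entry mulr_sumr.
rewrite [RHS]exchange_big; apply: eq_bigr => l _.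
under [RHS]eq_bigr do rewrite mulr_sumr.
rewrite [RHS]exchange_big; apply: eq_bigr => k _.
under [RHS]eq_bigr do rewrite mulrA.
rewrite -mulr_suml; congr (_ * _); rewrite !mxE /=.
case: ifP => h1; last by rewrite mul0r big1 // => j _; rewrite !mxE /= h1 mul0r mulr0.
case: ifP => h2; last first.
  rewrite rmorph0 mulr0 big1 // => j _; rewrite !mxE /= h2.
  by rewrite rmorph0 !mulr0.
by rewrite hr; apply: eq_bigr => j _; rewrite !mxE /= h1 h2.
Qed.

Lemma expansion_exists (R : realType) (S : finType) (d : S -> nat) (E : finType)
    (supp : E -> {set S}) (HI : E -> op R d) (gamma : E -> R)
    (m : E -> nat) (A : forall l : E, 'I_(m l) -> lop R d (supp l)) :
  (forall l, HI l \is hermsymmx) -> (forall l, acts_on (supp l) (HI l)) ->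
  (forall l, chan_span (A l)) ->
  exists (q0 : R) (q : forall l : E, 'I_(m l) -> R), expansion A HI gamma q0 q.
Proof.
move=> hI hloc hA.
have hr l : exists r : 'I_(m l) -> R, forall rho : op R d,
    HI l *m rho *m HI l = \sum_j (r j)%:C *: chan (embed (A l j)) rho.
  have [h hh] := hloc l; have [r hr] := chan_span_real h (hA l).
  exists r => rho; rewrite -(chan_embed_combination hr) -hh /chan.
  by rewrite (hermsymmx_dag (hI l)).
(* Spanning already expresses each H_l rho H_l by channels on the support of l, so the identity
   coefficient can be chosen 0. *)
exists 0, (fun l j => - (2 * gamma l * sval (boolp.cid (hr l)) j)) => rho.
rewrite rmorph0 scale0r add0r /LJ -sumrN; apply: eq_bigr => l _.
rewrite (svalP (boolp.cid (hr l))) scaler_sumr -sumrN; apply: eq_bigr => j _.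
by rewrite scalerA -rmorphM rmorphN scaleNr.
Qed.

(** * Error of one step and of its iterates *)

Lemma evol_euler_error (R : realType) (N : nat) (G : 'M[R[i]]_N)
    (F : 'M[R[i]]_N -> 'M[R[i]]_N) : bounded F ->
  (forall X, F X = G *m X + X *m G ^t*) ->
  exists2 c : R, 0 <= c & forall t X, 0 <= t <= 1 ->
    nu (evol F t X - chan (1%:M + t%:C *: G) X) <= c * t ^+ 2 * nu X.
Proof.
move=> [b b0 hb] hF; exists (N%:R ^+ 2 * 2 * expR b + nu G ^+ 2).
  by rewrite addr_ge0 ?sqr_ge0 // !mulr_ge0 ?expR_ge0 ?exprn_ge0.
move=> t X ht; have h1 := evol_taylor X ht b0 hb.
rewrite chan_eulerE -hF opprD addrA.
apply: (le_trans (nuB _ _)); rewrite (mulrDl (_ * expR b)) (mulrDl _ _ (nu X)).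
apply: lerD => //.
rewrite nuZr ?sqr_ge0 // (mulrC (nu G ^+ 2)) -(mulrA (t ^+ 2)).
by apply: ler_wpM2l; [exact: sqr_ge0 | exact: nu_chan].
Qed.

(** With Y = exp(t L) X and r its Taylor remainder, the first-order jump terms cancel and leave r -
    t J(Y - X) - t^2 G X G^*; all three are O(t^2), since Y - X = O(t). *)
Lemma jump_step_euler_error (R : realType) (N : nat) (G : 'M[R[i]]_N)
    (L J : 'M[R[i]]_N -> 'M[R[i]]_N) : bounded L -> bounded J -> real_linear J ->
  (forall X, L X = G *m X + X *m G ^t* + J X) ->
  exists2 c : R, 0 <= c & forall t X, 0 <= t <= 1 ->
    nu (evol L t X - t%:C *: J (evol L t X) - chan (1%:M + t%:C *: G) X)
    <= c * t ^+ 2 * nu X.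
Proof.
move=> [b b0 hb] [b' b'0 hb'] lJ hL.
set C := N%:R ^+ 2 * 2 * expR b.
have C0 : 0 <= C by rewrite !mulr_ge0 ?expR_ge0 ?exprn_ge0.
exists (C + b' * (b + C) + nu G ^+ 2).
  by rewrite !addr_ge0 ?sqr_ge0 // mulr_ge0 // addr_ge0.
move=> t X ht; have h1 := evol_taylor X ht b0 hb; rewrite -/C in h1.
have /andP[t0 t1] := ht; have X0 := nu_ge0 X.
set Y := evol L t X in h1 *; set r := Y - (X + t%:C *: L X) in h1.
have YX : Y - X = t%:C *: L X + r by rewrite /r opprD (addrA Y) [RHS]addrC subrK.
have e : Y - t%:C *: J Y - chan (1%:M + t%:C *: G) X
    = r - t%:C *: J (Y - X) - (t ^+ 2)%:C *: chan G X.
  rewrite chan_eulerE real_linearB // opprD addrA; congr (_ - _).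
  rewrite /r hL (scalerDr _ (_ + _)) scalerBr.
  have abel (u v w z x : 'M[R[i]]_N) :
      u - v - (w + z) = u - (w + (z + x)) - (v - x).
    by apply/matrixP => i j; rewrite !mxE; ring.
  exact: abel.
have hYX : nu (Y - X) <= t * ((b + C) * nu X).
  rewrite YX; apply: (le_trans (nuD _ _)); rewrite nuZr // mulrDl mulrDr.
  apply: lerD; first by apply: ler_wpM2l.
  apply: (le_trans h1); rewrite (mulrCA t) -(mulrA C); apply: ler_wpM2l => //.
  by apply: ler_wpM2r => //; rewrite expr2 ler_piMl.
rewrite e; apply: (le_trans (nuB _ _)).
rewrite mulrDl mulrDl; apply: lerD.
  apply: (le_trans (nuB _ _)); rewrite mulrDl mulrDl; apply: lerD => //.
  rewrite nuZr //; apply: (@le_trans _ _ (t * (b' * (t * ((b + C) * nu X))))).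
    by apply: ler_wpM2l => //; apply: (le_trans (hb' _)); apply: ler_wpM2l.
  by rewrite le_eqVlt; apply/orP; left; apply/eqP; ring.
rewrite nuZr ?sqr_ge0 // (mulrC (nu G ^+ 2)) -(mulrA (t ^+ 2)).
by apply: ler_wpM2l; [exact: sqr_ge0 | exact: nu_chan].
Qed.

(** Telescoping n errors of size c t^2; the condition n t^2 <= 1 also bounds the accumulated factor
    (1 + c B t^2)^n by exp(c B), so K depends on neither n nor t. *)
Lemma iter_euler_error (R : realType) (N : nat) (G : 'M[R[i]]_N)
    (M : R -> 'M[R[i]]_N -> 'M[R[i]]_N) (c : R) : dissipative G -> 0 <= c ->
  (forall t X, 0 <= t <= 1 ->
    nu (M t X - chan (1%:M + t%:C *: G) X) <= c * t ^+ 2 * nu X) ->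
  exists2 K : R, 0 <= K & forall t n X, 0 <= t <= 1 -> n%:R * t ^+ 2 <= 1 ->
    nu (iter n (M t) X - iter n (chan (1%:M + t%:C *: G)) X)
    <= K * (n%:R * t ^+ 2) * nu X.
Proof.
move=> hG c0 hM; have [B B0 hB] := iter_chan_bound hG.
exists (c * B ^+ 2 * expR (c * B)).
  by rewrite !mulr_ge0 ?expR_ge0 // sqr_ge0.
move=> t n X ht hn; have /andP[t0 t1] := ht.
have t2 := sqr_ge0 t; have n0 : 0 <= n%:R :> R by rewrite ler0n.
have hP k : (k <= n)%N -> bounded_by (iter k (chan (1%:M + t%:C *: G))) B.
  move=> kn; apply: hB => //; apply: le_trans hn.
  by apply: ler_wpM2r => //; rewrite ler_nat.
have ct0 : 0 <= c * t ^+ 2 by apply: mulr_ge0.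
have := iter_perturb X (real_linear_chan _) B0 ct0 hP (fun Y => hM t Y ht).
move/le_trans; apply.
have hE : (1 + c * t ^+ 2 * B) ^+ n <= expR (c * B).
  have h0 : 0 <= c * t ^+ 2 * B by apply: mulr_ge0.
  apply: (le_trans (expr1D_le_expR n h0)); rewrite ler_expR.
  have -> : n%:R * (c * t ^+ 2 * B) = c * B * (n%:R * t ^+ 2) by ring.
  by rewrite -[leRHS]mulr1; apply: ler_wpM2l => //; apply: mulr_ge0.
set g := (1 + _) ^+ n in hE *.
have -> : n%:R * (c * t ^+ 2 * B ^+ 2 * g * nu X)
  = (c * B ^+ 2 * (n%:R * t ^+ 2) * nu X) * g by ring.
have -> : c * B ^+ 2 * expR (c * B) * (n%:R * t ^+ 2) * nu X
  = (c * B ^+ 2 * (n%:R * t ^+ 2) * nu X) * expR (c * B) by ring.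
apply: ler_wpM2l => //; apply: mulr_ge0; last exact: nu_ge0.
by rewrite !mulr_ge0 // sqr_ge0.
Qed.

(** Uses a/b - a'/b' = -a (b - b')/(b b') + (a - a')/b', where 2 e <= k forces |b'| >= k/2. *)
Lemma normc_ratio_le (R : realType) (a b a' b' : R[i]) (e k C : R) :
  0 < k -> normc (a - a') <= e -> normc (b - b') <= e -> normc a <= C ->
  k <= normc b -> 2 * e <= k ->
  [/\ b != 0, b' != 0 & normc (a / b - a' / b') <= e * (2 * C / k ^+ 2 + 2 / k)].
Proof.
move=> k0 ha hb aC kb ek.
have nb' : k / 2 <= normc b'.
  have := ler_normcD (b - b') b'; rewrite subrK; lra.
have k2 : 0 < k / 2 by lra.
have nz (z : R[i]) (x : R) : 0 < x -> x <= normc z -> z != 0.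
  by move=> x0 xz; apply/eqP => z0; move: xz; rewrite z0 normc0; lra.
have b0 := nz b k k0 kb; have b'0 := nz b' _ k2 nb'.
split=> //.
have -> : a / b - a' / b' = a * - (b - b') / (b * b') + (a - a') / b'.
  by field; apply/andP.
have e0 : 0 <= e by apply: le_trans ha; apply: normc_ge0.
have C0 : 0 <= C by apply: le_trans aC; apply: normc_ge0.
apply: (le_trans (ler_normcD _ _)); rewrite !normcM !normcV normcM normc_opp.
have i1 : (normc b)^-1 <= k^-1 by rewrite lef_pV2 ?posrE //; lra.
have i2 : (normc b')^-1 <= (k / 2)^-1 by rewrite lef_pV2 ?posrE //; lra.
have p1 : 0 <= (normc b)^-1 by rewrite invr_ge0 normc_ge0.
have p2 : 0 <= (normc b')^-1 by rewrite invr_ge0 normc_ge0.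
have -> : e * (2 * C / k ^+ 2 + 2 / k) = C * e * (k^-1 * (k / 2)^-1) + e * (k / 2)^-1.
  by field; rewrite gt_eqF.
rewrite invfM; apply: lerD; last by apply: ler_pM => //; apply: normc_ge0.
apply: ler_pM; rewrite ?mulr_ge0 ?normc_ge0 //.
  by apply: ler_pM => //; apply: normc_ge0.
by apply: ler_pM.
Qed.

Lemma cfac_gt0 (R : realType) (E : finType) (m : E -> nat)
    (q0 : R) (q : forall l : E, 'I_(m l) -> R) :
  exists2 delta : R, 0 < delta & forall dt, 0 < dt < delta -> 0 < cfac q0 q dt.
Proof.
set a := q0 + \sum_l \sum_j `|q l j|.
have a1 : 0 < 1 + `|a| by rewrite ltr_pwDl.
(* The sum [a] can be negative through [q0]; this radius keeps dt |a| below 1. *)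
exists (1 + `|a|)^-1; first by rewrite invr_gt0.
move=> dt /andP[dt0]; rewrite -(ltr_pM2r a1) mulVf ?gt_eqF // => h.
rewrite /cfac -/a.
have h2 : dt * - `|a| <= dt * a by rewrite ler_pM2l // lerNl -normrN ler_norm.
by move: h h2; rewrite mulrDr mulr1 mulrN; lra.
Qed.

(** Collects, with constants independent of n and dt, what both claims use: the error estimate, a
    lower bound for the denominator and an upper bound for the numerator. *)
Lemma signed_avg_bounds (R : realType) (S : finType) (d : S -> nat)
    (E : finType) (supp : E -> {set S})
    (HRe : op R d) (HI : E -> op R d) (gamma : E -> R)
    (m : E -> nat) (A : forall l : E, 'I_(m l) -> lop R d (supp l))
    (q0 : R) (q : forall l : E, 'I_(m l) -> R) (rho0 : op R d) :
  HRe \is hermsymmx -> (forall l, HI l \is hermsymmx) ->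
  (forall l, 0 < gamma l) -> density rho0 -> expansion A HI gamma q0 q ->
  let L := gksl HRe HI gamma in
  exists K c delta : R, [/\ 0 <= K, 0 <= c, 0 < delta &
    forall (dt : R) (n : nat), 0 < dt < delta -> n%:R * dt * dt <= 1 ->
    [/\ 0 < cfac q0 q dt,
        expR (- (c * (n%:R * dt))) - K * (n%:R * dt * dt)
          <= complex.Re (\tr (rhoNH HRe HI gamma dt n rho0)) &
        forall Obs : op R d,
        normc (\tr (Obs *m rhoNH HRe HI gamma dt n rho0)
            - (cfac q0 q dt ^+ n)%:C * signed_avg A L q0 q dt n rho0 Obs)
          <= K * nu Obs * (n%:R * dt * dt)
        /\ normc (\tr (Obs *m rhoNH HRe HI gamma dt n rho0)) <= K * nu Obs]].
Proof.
move=> hH hI hg hrho hq L; set G := nh_gen HRe HI gamma.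
have hG : dissipative G by apply: nh_gen_dissipative.
have [c1 c10 h1] := evol_euler_error (LNH_bounded gamma hH hI)
  (fun X => LNHE gamma X hH hI).
have bL : bounded L by apply: boundedD; [exact: LNH_bounded | exact: LJ_bounded].
have lL : real_linear L.
  by apply: real_linear_add; [exact: LNH_linear | exact: LJ_linear].
have [c2 c20 h2] := jump_step_euler_error bL (LJ_bounded HI gamma)
  (LJ_linear HI gamma) (fun X => congr1 (+%R^~ _) (LNHE gamma X hH hI)).
have [K1 K10 hK1] := iter_euler_error hG c10 h1.
have [K2 K20 hK2] := iter_euler_error hG c20 h2.
have [B B0 hB] := iter_chan_bound hG.
have [c c0 hc] := tr_iter_chan_ge G.
have [d1 d10 hd1] := cfac_gt0 q0 q.
have r0 := nu_ge0 rho0.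
(* K1 and K2 are the distances of the two evolutions from the Euler iterate, and B bounds that
   iterate itself. *)
pose K := (K1 + K2 + B) * nu rho0.
have c2gt : 0 < 2 * c + 1 by lra.
(* The three caps give a positive [cfac], validity of the Taylor estimates, and c dt <= 1/2 for the
   trace bound. *)
pose delta := Num.min d1 (Num.min 1 (2 * c + 1)^-1).
exists K, (2 * c), delta; split.
- by apply: mulr_ge0 => //; rewrite !addr_ge0.
- by apply: mulr_ge0.
- by rewrite /delta !lt_min d10 ltr01 invr_gt0.
move=> dt n /andP[dt0]; rewrite /delta !lt_min => /and3P[dd1 dt1 dtc].
rewrite -mulrA -expr2 => hn.
have ht : 0 <= dt <= 1 by rewrite !ltW.
have cf : 0 < cfac q0 q dt by apply: hd1; rewrite dt0.
set rN := rhoNH _ _ _ _ _ _.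
set rP := iter n (chan (1%:M + dt%:C *: G)) rho0.
set s := n%:R * dt ^+ 2 in hn *.
have s0 : 0 <= s by rewrite mulr_ge0 ?ler0n ?sqr_ge0.
have e1 : nu (rN - rP) <= K1 * s * nu rho0 by exact: hK1.
have lE : real_linear (evol L dt).
  have [b b0 hb] := bL; exact: (evol_linear (ltW dt0) b0 hb lL).
have e2 : nu (iter n (mean_step A L q0 q dt) rho0 - rP) <= K2 * s * nu rho0.
  have -> : iter n (mean_step A L q0 q dt) rho0
      = iter n (fun X => evol L dt X - dt%:C *: LJ HI gamma (evol L dt X)) rho0.
    by apply: eq_iter => X; apply: mean_stepE.
  exact: hK2.
have K1K : K1 * nu rho0 <= K.
  by rewrite /K -addrA !mulrDl lerDl !addr_ge0 // mulr_ge0.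
split=> //.
  have ct : c * dt <= 2^-1.
    move: dtc; rewrite -(ltr_pM2r c2gt) mulVf ?gt_eqF // mulrDr mulr1.
    by rewrite mulrCA mulrA; lra.
  have := hc rho0 dt n (ltW dt0) ct hrho; rewrite -/rP.
  have -> : n%:R * (2 * (c * dt)) = 2 * c * (n%:R * dt) by ring.
  have h3 : - (K * s) <= complex.Re (\tr (rN - rP)).
    rewrite lerNl -ReN; apply: (le_trans (ler_norm _)).
    apply: (le_trans (Re_le_normc _)); rewrite normc_opp.
    apply: (le_trans (normc_tr _)); apply: (le_trans e1).
    by rewrite mulrAC; apply: ler_wpM2r.
  have -> : complex.Re (\tr rN)
      = complex.Re (\tr rP) + complex.Re (\tr (rN - rP)).
    by rewrite -ReD -mxtraceD addrC subrK.
  by move: h3; lra.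
move=> Obs; have O0 := nu_ge0 Obs; split.
  rewrite cfac_signed_avg ?gt_eqF // -raddfB -mulmxBr.
  apply: (le_trans (normc_tr _)); apply: (le_trans (nu_mul _ _)).
  rewrite (mulrC K) -mulrA; apply: ler_wpM2l => //.
  set rM := iter n (mean_step _ _ _ _ _) _ in e2 *.
  have -> : rN - rM = (rN - rP) - (rM - rP).
    by rewrite opprB addrA subrK.
  apply: (le_trans (nuB _ _)); apply: (le_trans (lerD e1 e2)).
  have Bs : 0 <= B * s * nu rho0 by apply: mulr_ge0 r0; apply: mulr_ge0 s0.
  by rewrite /K; lra.
apply: (le_trans (normc_tr _)); apply: (le_trans (nu_mul _ _)).
rewrite (mulrC K); apply: ler_wpM2l => //.
have -> : rN = (rN - rP) + rP by rewrite subrK.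
apply: (le_trans (nuD _ _)).
have hP : nu rP <= B * nu rho0 by apply: hB => //; rewrite ltW.
have h3 : K1 * s * nu rho0 <= K1 * nu rho0.
  by rewrite mulrAC ler_piMr // mulr_ge0.
have : 0 <= K2 * nu rho0 by rewrite mulr_ge0.
by rewrite /K !mulrDl; move: e1 hP h3; lra.
Qed.

Theorem mainTheorem1 (R : realType) (S : finType) (d : S -> nat)
    (d_gt0 : forall s : S, (0 < d s)%N)
    (E : finType) (supp : E -> {set S})
    (HRe : op R d) (HI : E -> op R d) (gamma : E -> R)
    (HRe_herm : HRe \is hermsymmx)
    (HI_herm : forall l : E, HI l \is hermsymmx)
    (HI_loc : forall l : E, acts_on (supp l) (HI l))
    (gamma_gt0 : forall l : E, 0 < gamma l)
    (m : E -> nat) (A : forall l : E, 'I_(m l) -> lop R d (supp l))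
    (A_contr : forall (l : E) (j : 'I_(m l)), contractive (A l j))
    (A_span : forall l : E, chan_span (A l))
    (rho0 : op R d) (rho0_density : density rho0)
    (Obs : op R d) (Obs_herm : Obs \is hermsymmx) :
  let L := gksl HRe HI gamma in
  (exists (q0 : R) (q : forall l : E, 'I_(m l) -> R),
     expansion A HI gamma q0 q)
  /\
  forall (q0 : R) (q : forall l : E, 'I_(m l) -> R),
    expansion A HI gamma q0 q ->
    (exists K delta : R, 0 < delta /\
       forall (T dt : R) (n : nat),
         0 < dt < delta -> T = n%:R * dt -> T * dt < delta ->
         `| \tr (Obs *m rhoNH HRe HI gamma dt n rho0)
            - (cfac q0 q dt ^+ n)%:C
              * signed_avg A L q0 q dt n rho0 Obs |
         <= (K * (T * dt))%:C)
    /\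
    (forall T eps : R, 0 <= T -> 0 < eps ->
       exists delta : R, 0 < delta /\
       forall (dt : R) (n : nat),
         0 < dt < delta -> T = n%:R * dt ->
         [/\ \tr (rhoNH HRe HI gamma dt n rho0) != 0,
             signed_avg A L q0 q dt n rho0 1%:M != 0
           & `| \tr (Obs *m rhoNH HRe HI gamma dt n rho0)
                  / \tr (rhoNH HRe HI gamma dt n rho0)
                - signed_avg A L q0 q dt n rho0 Obs
                  / signed_avg A L q0 q dt n rho0 1%:M | < eps%:C]).
Proof.
move=> L; split; first exact: expansion_exists.
move=> q0 q hq.
have [K [c [delta [K0 c0 d0 hb]]]] :=
  signed_avg_bounds HRe_herm HI_herm gamma_gt0 rho0_density hq.
have O0 := nu_ge0 Obs; have I0 := nu_ge0 (1%:M : op R d).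
split.
  (* The cap 1 turns T dt < delta into the condition T dt <= 1 of the uniform bounds. *)
  exists (K * nu Obs), (Num.min delta 1); split; first by rewrite lt_min d0 ltr01.
  move=> T dt n /andP[dt0]; rewrite !lt_min => /andP[dd _] -> /andP[_ hT].
  have [||_ _ h] := hb dt n; [by rewrite dt0 | exact: ltW |].
  by rewrite normr_normc lecR; case: (h Obs).
move=> T eps T0 e0.
(* Half of the lower bound exp(-c T) for the Euler trace; the other half absorbs the error in the
   denominator. *)
pose k := expR (- (c * T)) / 2.
have k0 : 0 < k by rewrite divr_gt0 ?expR_gt0.
(* A common majorant of the error constants for [Obs], for the identity and for the trace bound. *)
pose K' := K * (1 + nu Obs + nu (1%:M : op R d)).
have K'0 : 0 <= K' by rewrite mulr_ge0 // !addr_ge0.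
have KK' : K <= K'.
  have I1 : 0 <= K * nu (1%:M : op R d) by apply: mulr_ge0.
  have O1 : 0 <= K * nu Obs by apply: mulr_ge0.
  by move: I1 O1; rewrite /K' !mulrDr; lra.
pose D := 2 * (K * nu Obs) / k ^+ 2 + 2 / k.
have D0 : 0 <= D.
  apply: addr_ge0; apply: divr_ge0; rewrite ?exprn_ge0 ?(ltW k0) //.
  by apply: mulr_ge0 => //; apply: mulr_ge0.
(* The first bound gives 2 e <= k, the second e D < eps; adding 1 to D avoids a zero denominator. *)
pose eta := Num.min (k / 2) (eps / (D + 1)).
have D1 : 0 < D + 1 by lra.
have eta0 : 0 < eta.
  by rewrite lt_min; apply/andP; split; apply: divr_gt0 => //; rewrite ltr0n.
have KT : 0 < K' * T + 1 by rewrite ltr_wpDl // mulr_ge0.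
have T1 : 0 < T + 1 by lra.
(* The middle bound forces T dt <= 1 and the last one K' T dt < eta; the added 1's cover T = 0. *)
exists (Num.min delta (Num.min (T + 1)^-1 (eta / (K' * T + 1)))); split.
  by rewrite !lt_min d0 invr_gt0 T1 divr_gt0.
move=> dt n /andP[dt0]; rewrite !lt_min => /and3P[dd dT deta] hT.
have dd' : 0 < dt < delta by rewrite dt0.
have hTdt : T * dt <= 1.
  by move: dT; rewrite -(ltr_pM2l T1) mulfV ?gt_eqF // mulrDl mul1r; lra.
have [||cf htr hO] := hb dt n; [by [] | by rewrite -hT |].
rewrite -hT in htr hO.
set e := K' * (T * dt).
have Td0 : 0 <= T * dt by rewrite mulr_ge0 // ltW.
have eE : e < eta.
  move: deta; rewrite ltr_pdivlMr // mulrDr mulr1 /e mulrA [dt * _]mulrC.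
  by lra.
have ek : e < k / 2 by move: eE; rewrite lt_min => /andP[].
have eD : e * (D + 1) < eps by move: eE; rewrite lt_min (ltr_pdivlMr _ _ D1) => /andP[].
have e00 : 0 <= e by rewrite mulr_ge0.
have KO : K * nu Obs <= K'.
  by rewrite /K' ler_wpM2l //; lra.
have KI : K * nu (1%:M : op R d) <= K'.
  by rewrite /K' ler_wpM2l //; lra.
have [hO1 hO2] := hO Obs; have [hI1 hI2] := hO 1%:M.
rewrite mul1mx in hI1 hI2.
set a := \tr (Obs *m _) in hO1 hO2 *; set b := \tr _ in htr hI1 hI2 *.
set C := (cfac _ _ _ ^+ n)%:C in hO1 hI1.
have C0 : C != 0.
  by rewrite (inj_eq (@complexI R)) expf_neq0 // gt_eqF.
set a' := signed_avg _ _ _ _ _ _ _ Obs in hO1 *.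
set b' := signed_avg _ _ _ _ _ _ _ _ in hI1 *.
have kb : k <= normc b.
  apply: le_trans (Re_le_normc _); apply: le_trans (ler_norm _).
  apply: le_trans htr.
  have : K * (T * dt) <= e by rewrite ler_wpM2r.
  by move: ek; rewrite /k; lra.
have h1 : normc (a - C * a') <= e.
  by apply: (le_trans hO1); rewrite ler_wpM2r.
have h2 : normc (b - C * b') <= e.
  by apply: (le_trans hI1); rewrite ler_wpM2r.
have e2k : 2 * e <= k by lra.
have [b0 Cb0 h] := normc_ratio_le k0 h1 h2 hO2 kb e2k.
have b'0 : b' != 0 by move: Cb0; rewrite mulf_eq0 negb_or => /andP[].
split=> //; rewrite normr_normc ltcR.
(* The estimates concern the averages multiplied by [cfac ^+ n], a nonzero factor that cancels in
   the quotient. *)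
have <- : C * a' / (C * b') = a' / b' by rewrite -mulf_div divff // mul1r.
by apply: (le_lt_trans h); rewrite -/D; move: eD; rewrite mulrDr mulr1; lra.
Qed.
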